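(* Let $\mathcal{C}$ be a braided near-integral fusion category with $\mathrm{FPdim}(\mathcal{C})\in\mathbb{Z}$, with distinguished fusion subcategory $\mathcal{D}$ and distinguished simple object $\rho$, and let $\kappa:=\dim_{\mathbb{C}}\mathrm{Hom}_{\mathcal{C}}(\rho,\rho\otimes\rho)$. If $C_\mathcal{D}(\mathcal{D})$ is super-Tannakian, then $\mathcal{D}=C_\mathcal{D}(\mathcal{D})$, $\kappa=0$ and $\theta_\rho^{16}=1$.
   Context: Fusion categories are over $\mathbb{C}$; rank is the number of isomorphism classes of simple objects; $\mathrm{FPdim}$ is Frobenius-Perron dimension. A fusion category $\mathcal{C}$ is near-integral if it has a fusion subcategory $\mathcal{D}\subset\mathcal{C}$ with $\mathrm{rank}(\mathcal{D})+1=\mathrm{rank}(\mathcal{C})$; $\rho$ is the unique (up to isomorphism) simple object of $\mathcal{C}$ not in $\mathcal{D}$. For a braided fusion category $\mathcal{D}$ with braiding $\sigma$, the symmetric center $C_\mathcal{D}(\mathcal{D})$ is the fusion subcategory of objects $X$ with $\sigma_{Y,X}\sigma_{X,Y}=\mathrm{id}_{X\otimes Y}$ for all $Y\in\mathcal{D}$. Every symmetrically braided fusion category is braided equivalent to $\mathrm{Rep}(G,\nu)$ for a finite group $G$ and central $\nu\in G$ with $\nu^2=e$ (representations of $G$ with the braiding modified by the super-sign determined by the action of $\nu$); it is Tannakian if $\nu=e$ and super-Tannakian if $\nu\neq e$. Since $\mathrm{FPdim}(\mathcal{C})\in\mathbb{Z}$, $\mathcal{C}$ is pseudounitary and is equipped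 with its canonical spherical structure, for which $\dim(X)=\mathrm{FPdim}(X)$ for all objects $X$; $\theta_\rho\in\mathbb{C}^\times$ is the corresponding twist of $\rho$. *)

(* Defs.v *)
From HB Require Import structures.
From mathcomp Require Import all_boot all_order all_algebra all_fingroup.
From mathcomp Require Import all_solvable mxrepresentation.
From mathcomp Require Import boolp classical_sets reals.
From mathcomp Require Import complex mxtens ring.

Set Implicit Arguments.
Unset Strict Implicit.
Unset Printing Implicit Defensive.

Import Order.TTheory GRing.Theory Num.Theory.
Local Open Scope ring_scope.

Reserved Notation "g \oc f" (at level 50, left associativity).
Reserved Notation "X \ox Y" (at level 40, left associativity).
Reserved Notation "f \om g" (at level 40, left associativity).

(* Categories enriched in finite-dimensional K-vector spaces; composition is
   written in applicative order. *)
Record linCat (K : fieldType) := LinCat {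
  ob :> Type;
  mor : ob -> ob -> vectType K;
  idm : forall X, mor X X;
  compm : forall X Y Z, mor Y Z -> mor X Y -> mor X Z;
  comp1m : forall X Y (f : mor X Y), compm (idm Y) f = f;
  compm1 : forall X Y (f : mor X Y), compm f (idm X) = f;
  compA : forall X Y Z W (h : mor Z W) (g : mor Y Z) (f : mor X Y),
    compm h (compm g f) = compm (compm h g) f;
  comp_linl : forall X Y Z (f : mor X Y), linear (fun g : mor Y Z => compm g f);
  comp_linr : forall X Y Z (g : mor Y Z), linear (fun f : mor X Y => compm g f)
}.

Arguments mor {K l} X Y.
Arguments idm {K l} X.
Arguments compm {K l X Y Z} g f.
Notation "g \oc f" := (compm g f) : ring_scope.

Section LinearCategory.
Variables (K : fieldType) (C : linCat K).
Implicit Types X Y Z : C.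

Definition inverse_mors X Y (f : mor X Y) (g : mor Y X) :=
  g \oc f = idm X /\ f \oc g = idm Y.

Definition iso_mor X Y (f : mor X Y) := exists g, inverse_mors f g.

Definition isomorphic X Y := exists f : mor X Y, iso_mor f.

Definition mono_mor X Y (f : mor X Y) :=
  forall Z (g h : mor Z X), f \oc g = f \oc h -> g = h.

Definition epi_mor X Y (f : mor X Y) :=
  forall Z (g h : mor Y Z), g \oc f = h \oc f -> g = h.

Definition zero_ob X := idm X = 0.

Definition kernel_of X Y Z (f : mor X Y) (k : mor Z X) :=
  f \oc k = 0 /\
  forall W (g : mor W X), f \oc g = 0 -> exists! h : mor W Z, k \oc h = g.

Definition cokernel_of X Y Z (f : mor X Y) (q : mor Y Z) :=
  q \oc f = 0 /\
  forall W (g : mor Y W), g \oc f = 0 -> exists! h : mor Z W, h \oc q = g.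

(* X is a direct sum of the finite family Y; for n = 0, X is a zero object. *)
Definition direct_sum X n (Y : 'I_n -> C) :=
  exists (inj : forall i, mor (Y i) X) (prj : forall i, mor X (Y i)),
    [/\ forall i, prj i \oc inj i = idm (Y i),
        forall i j, i != j -> prj j \oc inj i = 0
      & \sum_(i < n) (inj i \oc prj i) = idm X].

Definition retract_of Y X :=
  exists (s : mor Y X) (r : mor X Y), r \oc s = idm Y.

Definition abelian_cat :=
  [/\ forall n (Y : 'I_n -> C), exists X, direct_sum X Y,
      forall X Y (f : mor X Y), exists Z (k : mor Z X), kernel_of f k,
      forall X Y (f : mor X Y), exists Z (q : mor Y Z), cokernel_of f q,
      forall X Y (f : mor X Y), mono_mor f ->
        exists Z (g : mor Y Z), kernel_of g f
    & forall X Y (f : mor X Y), epi_mor f ->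
        exists Z (g : mor Z X), cokernel_of g f].

Definition simple_ob X :=
  ~ zero_ob X /\
  forall Y (f : mor Y X), mono_mor f -> zero_ob Y \/ iso_mor f.

Definition semisimple_cat :=
  forall X, exists n (Y : 'I_n -> C),
    (forall i, simple_ob (Y i)) /\ direct_sum X Y.

End LinearCategory.

Record monCat (K : fieldType) := MonCat {
  mon_cat :> linCat K;
  unit_ob : mon_cat;
  tens : mon_cat -> mon_cat -> mon_cat;
  tensm : forall X X' Y Y',
    mor X X' -> mor Y Y' -> mor (tens X Y) (tens X' Y');
  tensm_id : forall X Y, tensm (idm X) (idm Y) = idm (tens X Y);
  tensm_comp : forall X X' X'' Y Y' Y''
    (f' : mor X' X'') (f : mor X X') (g' : mor Y' Y'') (g : mor Y Y'),
    tensm (f' \oc f) (g' \oc g) = tensm f' g' \oc tensm f g;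
  tensm_linl : forall X X' Y Y' (g : mor Y Y'),
    linear (fun f : mor X X' => tensm f g);
  tensm_linr : forall X X' Y Y' (f : mor X X'),
    linear (fun g : mor Y Y' => tensm f g);
  assoc : forall X Y Z, mor (tens (tens X Y) Z) (tens X (tens Y Z));
  assocV : forall X Y Z, mor (tens X (tens Y Z)) (tens (tens X Y) Z);
  assoc_iso : forall X Y Z, inverse_mors (assoc X Y Z) (assocV X Y Z);
  assoc_nat : forall X X' Y Y' Z Z'
    (f : mor X X') (g : mor Y Y') (h : mor Z Z'),
    assoc X' Y' Z' \oc tensm (tensm f g) h
    = tensm f (tensm g h) \oc assoc X Y Z;
  lunit : forall X, mor (tens unit_ob X) X;
  lunitV : forall X, mor X (tens unit_ob X);
  lunit_iso : forall X, inverse_mors (lunit X) (lunitV X);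
  lunit_nat : forall X X' (f : mor X X'),
    lunit X' \oc tensm (idm unit_ob) f = f \oc lunit X;
  runit : forall X, mor (tens X unit_ob) X;
  runitV : forall X, mor X (tens X unit_ob);
  runit_iso : forall X, inverse_mors (runit X) (runitV X);
  runit_nat : forall X X' (f : mor X X'),
    runit X' \oc tensm f (idm unit_ob) = f \oc runit X;
  pentagon : forall W X Y Z,
    tensm (idm W) (assoc X Y Z) \oc assoc W (tens X Y) Z
      \oc tensm (assoc W X Y) (idm Z)
    = assoc W X (tens Y Z) \oc assoc (tens W X) Y Z;
  triangle : forall X Y,
    tensm (idm X) (lunit Y) \oc assoc X unit_ob Y = tensm (runit X) (idm Y)
}.

Arguments unit_ob {K m}.
Arguments tens {K m} X Y.
Arguments tensm {K m X X' Y Y'} f g.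
Arguments assoc {K m} X Y Z.
Arguments assocV {K m} X Y Z.
Arguments lunit {K m} X.
Arguments lunitV {K m} X.
Arguments runit {K m} X.
Arguments runitV {K m} X.
Notation "X \ox Y" := (tens X Y) : ring_scope.
Notation "f \om g" := (tensm f g) : ring_scope.

Record braiding (K : fieldType) (M : monCat K) := Braiding {
  brd : forall X Y : M, mor (X \ox Y) (Y \ox X);
  brd_iso : forall X Y, iso_mor (brd X Y);
  brd_nat : forall (X X' Y Y' : M) (f : mor X X') (g : mor Y Y'),
    brd X' Y' \oc (f \om g) = (g \om f) \oc brd X Y;
  hexagon1 : forall X Y Z,
    assoc Y Z X \oc brd X (Y \ox Z) \oc assoc X Y Z
    = (idm Y \om brd X Z) \oc assoc Y X Z \oc (brd X Y \om idm Z);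
  hexagon2 : forall X Y Z,
    assocV Z X Y \oc brd (X \ox Y) Z \oc assocV X Y Z
    = (brd X Z \om idm Y) \oc assocV X Z Y \oc (idm X \om brd Y Z)
}.

(* Xd is a left dual of X (equivalently, X is a right dual of Xd). *)
Record duality (K : fieldType) (M : monCat K) (X Xd : M) := Duality {
  ev : mor (Xd \ox X) unit_ob;
  coev : mor unit_ob (X \ox Xd);
  zigzag1 : runit X \oc (idm X \om ev) \oc assoc X Xd X
              \oc (coev \om idm X) \oc lunitV X = idm X;
  zigzag2 : lunit Xd \oc (ev \om idm Xd) \oc assocV Xd X Xd
              \oc (idm Xd \om coev) \oc runitV Xd = idm Xd
}.

(* A choice of left duals and of representatives of the isomorphism classes of
   simple objects is part of the data. *)
Record fusionCat (K : fieldType) := FusionCat {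
  fus_mon :> monCat K;
  dual_ob : fus_mon -> fus_mon;
  dualP : forall X, duality X (dual_ob X);
  right_dualP : forall X, exists Y : fus_mon, inhabited (duality Y X);
  fus_abelian : abelian_cat fus_mon;
  fus_semisimple : semisimple_cat fus_mon;
  fus_unit : \dim {: mor (unit_ob : fus_mon) unit_ob} = 1%N;
  fus_rank : nat;
  irr : 'I_fus_rank -> fus_mon;
  irr_simple : forall i, simple_ob (irr i);
  irr_inj : forall i j, isomorphic (irr i) (irr j) -> i = j;
  irr_full : forall X, simple_ob X -> exists i, isomorphic X (irr i)
}.

Arguments dual_ob {K f} X.
Arguments dualP {K f} X.
Arguments irr {K} f i.
Arguments fus_rank {K} f.

Section FusionCategory.
Variables (K : fieldType) (C : fusionCat K).
Implicit Types X Y Z : C.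

(* Full subcategories are represented by predicates on objects. *)
Record fusion_subcat (D : C -> Prop) : Prop := FusionSubcat {
  fsub_unit : D unit_ob;
  fsub_tens : forall X Y, D X -> D Y -> D (X \ox Y);
  fsub_dual : forall X, D X -> D (dual_ob X);
  fsub_sum : forall X n (Y : 'I_n -> C),
    (forall i, D (Y i)) -> direct_sum X Y -> D X;
  fsub_retract : forall X Y, D X -> retract_of Y X -> D Y
}.

Definition subrank (D : C -> Prop) := #|[pred i | `[< D (irr C i) >]]|.

Definition near_integral (D : C -> Prop) :=
  fusion_subcat D /\ (subrank D + 1 = fus_rank C)%N.

Definition symmetric_center (c : braiding C) (D : C -> Prop) X :=
  D X /\ forall Y, D Y -> brd c Y X \oc brd c X Y = idm (X \ox Y).

(* The morphism A -> X* that corresponds to a pairing A (x) X -> 1. *)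
Definition transpose A X (p : mor (A \ox X) unit_ob) : mor A (dual_ob X) :=
  lunit (dual_ob X) \oc (p \om idm (dual_ob X)) \oc assocV A X (dual_ob X)
    \oc (idm A \om coev (dualP X)) \oc runitV A.

Definition dualm X Y (f : mor X Y) : mor (dual_ob Y) (dual_ob X) :=
  transpose (ev (dualP Y) \oc (idm (dual_ob Y) \om f)).

(* The canonical isomorphism Y* (x) X* -> (X (x) Y)*. *)
Definition dual_tens X Y : mor (dual_ob Y \ox dual_ob X) (dual_ob (X \ox Y)) :=
  transpose
    (ev (dualP Y)
     \oc (idm (dual_ob Y) \om (lunit Y \oc (ev (dualP X) \om idm Y)
                              \oc assocV (dual_ob X) X Y))
     \oc assoc (dual_ob Y) (dual_ob X) (X \ox Y)).

(* The trace of a : X -> X** is an endomorphism of the unit object. *)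
Definition trace_mor X (a : mor X (dual_ob (dual_ob X))) :
    mor (unit_ob : C) unit_ob :=
  ev (dualP (dual_ob X)) \oc (a \om idm (dual_ob X)) \oc coev (dualP X).

(* A pivotal structure is a monoidal natural isomorphism X -> X**. The
   monoidal structure X** (x) Y** -> (X (x) Y)** of the double dual functor is
   (dualm (dual_tens X Y))^-1 \oc dual_tens (dual_ob Y) (dual_ob X);
   [sph_tens] has its inverted factor on the other side. *)
Record spherical_structure := SphericalStructure {
  sph : forall X, mor X (dual_ob (dual_ob X));
  sph_iso : forall X, iso_mor (sph X);
  sph_nat : forall X Y (f : mor X Y),
    sph Y \oc f = dualm (dualm f) \oc sph X;
  sph_tens : forall X Y,
    dualm (dual_tens X Y) \oc sph (X \ox Y)
    = dual_tens (dual_ob Y) (dual_ob X) \oc (sph X \om sph Y);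
  sph_dim : forall X, trace_mor (sph X) = trace_mor (sph (dual_ob X))
}.

(* The Drinfeld morphism X -> X (x) X* (x) X** -> X* (x) X (x) X** -> X**. *)
Definition drinfeld (c : braiding C) X : mor X (dual_ob (dual_ob X)) :=
  transpose (ev (dualP X) \oc brd c X (dual_ob X)).

(* The twist theta is defined by psi = drinfeld \oc theta. On a simple object
   it is a scalar, which is the value here (0 if there is no such scalar). *)
Definition twist (c : braiding C) (psi : spherical_structure) X : K :=
  xget 0 [set t : K | sph psi X = drinfeld c X \oc (t *: idm X)]%classic.

End FusionCategory.

Section FrobeniusPerron.
Variables (R : realType) (K : fieldType) (C : fusionCat K).

(* The matrix of left multiplication by X on the Grothendieck ring, in the
   basis of simple objects. *)
Definition fusion_mx (X : C) : 'M[R]_(fus_rank C) :=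
  \matrix_(i, j) (\dim {: mor (irr C i) (X \ox irr C j)})%:R.

(* The set is finite and, by Perron-Frobenius, nonempty: sup is the maximum. *)
Definition FPdim_ob (X : C) : R :=
  sup [set x : R | 0 <= x /\ eigenvalue (fusion_mx X) x]%classic.

Definition FPdim : R := \sum_i FPdim_ob (irr C i) ^+ 2.

End FrobeniusPerron.

Arguments FPdim_ob R {K C} X.
Arguments FPdim R {K} C.

Definition canonical_spherical (R : realType) (C : fusionCat R[i])
    (psi : spherical_structure C) :=
  forall X : C,
    trace_mor (sph psi X) = (FPdim_ob R X)%:C%C *: idm (unit_ob : C).

Record braidedFunctor (K : fieldType) (M N : monCat K)
    (c : braiding M) (d : braiding N) := BraidedFunctor {
  fob :> M -> N;
  fmor : forall X Y, mor X Y -> mor (fob X) (fob Y);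
  fmor_id : forall X, fmor (idm X) = idm (fob X);
  fmor_comp : forall X Y Z (g : mor Y Z) (f : mor X Y),
    fmor (g \oc f) = fmor g \oc fmor f;
  fmor_lin : forall X Y, linear (@fmor X Y);
  funit : mor unit_ob (fob unit_ob);
  funit_iso : iso_mor funit;
  ftens : forall X Y, mor (fob X \ox fob Y) (fob (X \ox Y));
  ftens_iso : forall X Y, iso_mor (ftens X Y);
  ftens_nat : forall X X' Y Y' (f : mor X X') (g : mor Y Y'),
    ftens X' Y' \oc (fmor f \om fmor g) = fmor (f \om g) \oc ftens X Y;
  ftens_assoc : forall X Y Z,
    fmor (assoc X Y Z) \oc ftens (X \ox Y) Z \oc (ftens X Y \om idm (fob Z))
    = ftens X (Y \ox Z) \oc (idm (fob X) \om ftens Y Z)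
        \oc assoc (fob X) (fob Y) (fob Z);
  ftens_lunit : forall X,
    fmor (lunit X) \oc ftens unit_ob X \oc (funit \om idm (fob X))
    = lunit (fob X);
  ftens_runit : forall X,
    fmor (runit X) \oc ftens X unit_ob \oc (idm (fob X) \om funit)
    = runit (fob X);
  ftens_brd : forall X Y,
    fmor (brd c X Y) \oc ftens X Y = ftens Y X \oc brd d (fob X) (fob Y)
}.

(* F restricts to an equivalence from its source onto the full replete
   subcategory of its target whose objects satisfy P. *)
Definition equivalence_onto (K : fieldType) (M N : monCat K)
    (c : braiding M) (d : braiding N) (F : braidedFunctor c d)
    (P : N -> Prop) :=
  (forall X Y : M, bijective (@fmor _ _ _ _ _ F X Y)) /\
  (forall Y : N, P Y <-> exists X : M, isomorphic (F X) Y).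

Local Arguments mxtens_index : simpl never.
Local Arguments mxtens_unindex : simpl never.

Section PermutationMatrices.
Variable K : fieldType.

(* The linear map e_j |-> e_(f j). *)
Definition pmx m n (f : 'I_m -> 'I_n) : 'M[K]_(n, m) :=
  \matrix_(i, j) (i == f j)%:R.

Lemma mul_mx_pmx m n p (A : 'M[K]_(p, n)) (f : 'I_m -> 'I_n) i j :
  (A *m pmx f) i j = A i (f j).
Proof.
rewrite mxE (bigD1 (f j)) //= mxE eqxx mulr1 big1 ?addr0 // => k /negPf nk.
by rewrite mxE nk mulr0.
Qed.

Lemma mul_pmx_mx m n p (A : 'M[K]_(m, p)) (f : 'I_m -> 'I_n) g i j :
  cancel f g -> cancel g f -> (pmx f *m A) i j = A (g i) j.
Proof.
move=> fK gK; rewrite mxE (bigD1 (g i)) //= mxE gK eqxx mul1r.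
rewrite big1 ?addr0 // => k /negPf nk; rewrite mxE.
by case: eqP => [ik|_]; [rewrite ik fK eqxx in nk | rewrite mul0r].
Qed.

Lemma pmx_comp m n p (f : 'I_m -> 'I_n) (g : 'I_n -> 'I_p) :
  pmx g *m pmx f = pmx (g \o f).
Proof. by apply/matrixP=> i j; rewrite mul_mx_pmx !mxE. Qed.

Lemma eq_pmx m n (f g : 'I_m -> 'I_n) : f =1 g -> pmx f = pmx g.
Proof. by move=> fg; apply/matrixP=> i j; rewrite !mxE fg. Qed.

Lemma pmx_id n (f : 'I_n -> 'I_n) : f =1 id -> pmx f = 1%:M.
Proof. by move=> fE; apply/matrixP=> i j; rewrite !mxE fE. Qed.

Definition tensf m m' n n' (f : 'I_m -> 'I_m') (g : 'I_n -> 'I_n')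
    (k : 'I_(m * n)) : 'I_(m' * n') :=
  let ij := mxtens_unindex k in mxtens_index (f ij.1, g ij.2).

Lemma tens_pmx m m' n n' (f : 'I_m -> 'I_m') (g : 'I_n -> 'I_n') :
  pmx f *t pmx g = pmx (tensf f g).
Proof.
apply/matrixP=> i j; case: (mxtens_indexP i) => i1 i2.
case: (mxtens_indexP j) => j1 j2; rewrite tensmxE !mxE /tensf !mxtens_indexK /=.
rewrite -natrM mulnb (can_eq (@mxtens_indexK _ _)).
by rewrite /eq_op /=.
Qed.

Lemma tens1mx1 m n : (1%:M : 'M[K]_m) *t (1%:M : 'M[K]_n) = 1%:M.
Proof.
rewrite -(pmx_id (f := id)) // -(pmx_id (n := n) (f := id)) // tens_pmx.
by apply: pmx_id => k; rewrite /tensf -[RHS]mxtens_unindexK; case: mxtens_unindex.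
Qed.

Definition assocf m n p (k : 'I_(m * n * p)) : 'I_(m * (n * p)) :=
  let ij_k := mxtens_unindex k in let ij := mxtens_unindex ij_k.1 in
  mxtens_index (ij.1, mxtens_index (ij.2, ij_k.2)).

Definition assocVf m n p (k : 'I_(m * (n * p))) : 'I_(m * n * p) :=
  let i_jk := mxtens_unindex k in let jk := mxtens_unindex i_jk.2 in
  mxtens_index (mxtens_index (i_jk.1, jk.1), jk.2).

Definition swapf m n (k : 'I_(m * n)) : 'I_(n * m) :=
  let ij := mxtens_unindex k in mxtens_index (ij.2, ij.1).

Definition lunitf n (k : 'I_(1 * n)) : 'I_n := (mxtens_unindex k).2.
Definition lunitVf n (k : 'I_n) : 'I_(1 * n) := mxtens_index (ord0, k).
Definition runitf n (k : 'I_(n * 1)) : 'I_n := (mxtens_unindex k).1.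
Definition runitVf n (k : 'I_n) : 'I_(n * 1) := mxtens_index (k, ord0).

Lemma assocfK m n p : cancel (@assocf m n p) (@assocVf m n p).
Proof.
move=> k; case: (mxtens_indexP k) => ij l; case: (mxtens_indexP ij) => i j.
by rewrite /assocVf /assocf !mxtens_indexK.
Qed.

Lemma assocVfK m n p : cancel (@assocVf m n p) (@assocf m n p).
Proof.
move=> k; case: (mxtens_indexP k) => i jl; case: (mxtens_indexP jl) => j l.
by rewrite /assocVf /assocf !mxtens_indexK.
Qed.

Lemma swapfK m n : cancel (@swapf m n) (@swapf n m).
Proof.
by move=> k; case: (mxtens_indexP k) => i j; rewrite /swapf !mxtens_indexK.
Qed.

Lemma lunitfK n : cancel (@lunitf n) (@lunitVf n).
Proof.
move=> k; case: (mxtens_indexP k) => i j.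
by rewrite /lunitf /lunitVf mxtens_indexK (ord1 i).
Qed.

Lemma lunitVfK n : cancel (@lunitVf n) (@lunitf n).
Proof. by move=> k; rewrite /lunitf /lunitVf mxtens_indexK. Qed.

Lemma runitfK n : cancel (@runitf n) (@runitVf n).
Proof.
move=> k; case: (mxtens_indexP k) => i j.
by rewrite /runitf /runitVf mxtens_indexK (ord1 j).
Qed.

Lemma runitVfK n : cancel (@runitVf n) (@runitf n).
Proof. by move=> k; rewrite /runitf /runitVf mxtens_indexK. Qed.

Lemma pmxK m n (f : 'I_m -> 'I_n) g : cancel f g -> pmx g *m pmx f = 1%:M.
Proof. by move=> fK; rewrite pmx_comp pmx_id. Qed.

Lemma assocf_nat m m' n n' p p'
    (A : 'M[K]_(m', m)) (B : 'M[K]_(n', n)) (D : 'M[K]_(p', p)) :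
  pmx (@assocf m' n' p') *m (A *t B *t D)
  = A *t (B *t D) *m pmx (@assocf m n p).
Proof.
apply/matrixP=> i j.
rewrite mul_mx_pmx (mul_pmx_mx _ _ _ (@assocfK _ _ _) (@assocVfK _ _ _)).
case: (mxtens_indexP i) => i1 i23; case: (mxtens_indexP i23) => i2 i3.
case: (mxtens_indexP j) => j12 j3; case: (mxtens_indexP j12) => j1 j2.
by rewrite /assocf /assocVf !mxtens_indexK !tensmxE mulrA.
Qed.

Lemma assocVf_nat m m' n n' p p'
    (A : 'M[K]_(m', m)) (B : 'M[K]_(n', n)) (D : 'M[K]_(p', p)) :
  pmx (@assocVf m' n' p') *m (A *t (B *t D))
  = A *t B *t D *m pmx (@assocVf m n p).
Proof.
rewrite -[LHS]mulmx1 -(pmxK (@assocVfK m n p)) mulmxA -[X in X *m _]mulmxA.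
by rewrite -assocf_nat mulmxA (pmxK (@assocfK _ _ _)) mul1mx.
Qed.

Lemma swapf_nat m m' n n' (A : 'M[K]_(m', m)) (B : 'M[K]_(n', n)) :
  pmx (@swapf m' n') *m (A *t B) = B *t A *m pmx (@swapf m n).
Proof.
apply/matrixP=> i j.
rewrite mul_mx_pmx (mul_pmx_mx _ _ _ (@swapfK _ _) (@swapfK _ _)).
case: (mxtens_indexP i) => i1 i2; case: (mxtens_indexP j) => j1 j2.
by rewrite /swapf !mxtens_indexK /= !tensmxE mulrC.
Qed.

Lemma lunitf_nat m n (A : 'M[K]_(m, n)) :
  pmx (@lunitf m) *m ((1%:M : 'M_1) *t A) = A *m pmx (@lunitf n).
Proof.
apply/matrixP=> i j.
rewrite mul_mx_pmx (mul_pmx_mx _ _ _ (@lunitfK _) (@lunitVfK _)).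
case: (mxtens_indexP j) => j1 j2; rewrite /lunitf /lunitVf mxtens_indexK /=.
by rewrite tensmxE mxE (ord1 j1) mul1r.
Qed.

Lemma runitf_nat m n (A : 'M[K]_(m, n)) :
  pmx (@runitf m) *m (A *t (1%:M : 'M_1)) = A *m pmx (@runitf n).
Proof.
apply/matrixP=> i j.
rewrite mul_mx_pmx (mul_pmx_mx _ _ _ (@runitfK _) (@runitVfK _)).
case: (mxtens_indexP j) => j1 j2; rewrite /runitf /runitVf mxtens_indexK /=.
by rewrite tensmxE mxE (ord1 j2) mulr1.
Qed.

Lemma pmx_canL m n (f : 'I_m -> 'I_n) g p (A : 'M[K]_(m, p)) B :
  cancel f g -> pmx f *m A = B -> A = pmx g *m B.
Proof. by move=> fK <-; rewrite mulmxA pmxK // mul1mx. Qed.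

Lemma tensmxDl m n p q (A A' : 'M[K]_(m, n)) (B : 'M[K]_(p, q)) :
  (A + A') *t B = A *t B + A' *t B.
Proof. by apply/matrixP=> i j; rewrite !mxE mulrDl. Qed.

Lemma tensmxDr m n p q (A : 'M[K]_(m, n)) (B B' : 'M[K]_(p, q)) :
  A *t (B + B') = A *t B + A *t B'.
Proof. by apply/matrixP=> i j; rewrite !mxE mulrDr. Qed.

Lemma tensmxZl m n p q a (A : 'M[K]_(m, n)) (B : 'M[K]_(p, q)) :
  (a *: A) *t B = a *: (A *t B).
Proof. by apply/matrixP=> i j; rewrite !mxE mulrA. Qed.

Lemma tensmxZr m n p q a (A : 'M[K]_(m, n)) (B : 'M[K]_(p, q)) :
  A *t (a *: B) = a *: (A *t B).
Proof. by apply/matrixP=> i j; rewrite !mxE mulrCA. Qed.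

End PermutationMatrices.

Section Representations.
Variables (K : numFieldType) (gT : finGroupType) (G : {group gT}).

(* Representations act on column vectors; every finite-dimensional
   representation is isomorphic to one of these. *)
Record rep_ob := RepOb { rdim : nat; rep_mx :> mx_representation K G rdim }.
Implicit Types U V W : rep_ob.

Lemma mxrepM V x y : x \in G -> y \in G -> V (x * y)%g = V x *m V y.
Proof. exact: repr_mxM. Qed.

Definition intertw_defect V W x (f : 'M[K]_(rdim W, rdim V)) :=
  f *m V x - W x *m f.

Lemma intertw_defect_linear V W x : linear (@intertw_defect V W x).
Proof.
move=> a f g; rewrite /intertw_defect mulmxDl mulmxDr -scalemxAl -scalemxAr.
by rewrite scalerBr opprD addrACA.
Qed.

HB.instance Definition _ V W x :=
  GRing.isLinear.Build K 'M[K]_(rdim W, rdim V) 'M[K]_(rdim W, rdim V) _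
    (@intertw_defect V W x) (@intertw_defect_linear V W x).

Definition intertwiners V W : {vspace 'M[K]_(rdim W, rdim V)} :=
  (\bigcap_(x in G) lker (linfun (@intertw_defect V W x)))%VS.

Lemma intertwinersP V W (f : 'M[K]_(rdim W, rdim V)) :
  reflect (forall x, x \in G -> f *m V x = W x *m f) (f \in intertwiners V W).
Proof.
rewrite memvE; apply: (iffP subv_bigcapP) => fP x Gx; have:= fP x Gx.
  by rewrite -memvE memv_ker lfunE /= subr_eq0 => /eqP.
by move=> fx; rewrite -memvE memv_ker lfunE /= subr_eq0 fx.
Qed.

Definition rep_hom V W : vectType K := subvs_of (intertwiners V W).

Definition rep_mor V W (f : 'M[K]_(rdim W, rdim V))
    (fP : forall x, x \in G -> f *m V x = W x *m f) : rep_hom V W :=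
  Subvs (introT (intertwinersP f) fP).

Lemma rep_homP V W (f : rep_hom V W) x :
  x \in G -> vsval f *m V x = W x *m vsval f.
Proof. by move: x; apply/intertwinersP; case: f. Qed.

Lemma rep_hom_eq V W (f g : rep_hom V W) : vsval f = vsval g -> f = g.
Proof. exact: val_inj. Qed.

Lemma rep_hom_lin V W a (f g : rep_hom V W) :
  vsval (a *: f + g) = a *: vsval f + vsval g.
Proof. by []. Qed.

Fact rep_id_subproof V x : x \in G -> 1%:M *m V x = V x *m 1%:M.
Proof. by rewrite mul1mx mulmx1. Qed.

Definition rep_id V : rep_hom V V := rep_mor (@rep_id_subproof V).

Fact rep_comp_subproof U V W (g : rep_hom V W) (f : rep_hom U V) x :
  x \in G -> (vsval g *m vsval f) *m U x = W x *m (vsval g *m vsval f).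
Proof. by move=> Gx; rewrite -mulmxA rep_homP // !mulmxA rep_homP. Qed.

Definition rep_comp U V W (g : rep_hom V W) (f : rep_hom U V) : rep_hom U W :=
  rep_mor (rep_comp_subproof g f).

Fact rep_comp1m V W (f : rep_hom V W) : rep_comp (rep_id W) f = f.
Proof. by apply: rep_hom_eq; rewrite /= mul1mx. Qed.

Fact rep_compm1 V W (f : rep_hom V W) : rep_comp f (rep_id V) = f.
Proof. by apply: rep_hom_eq; rewrite /= mulmx1. Qed.

Fact rep_compA U V W X (h : rep_hom W X) (g : rep_hom V W) (f : rep_hom U V) :
  rep_comp h (rep_comp g f) = rep_comp (rep_comp h g) f.
Proof. by apply: rep_hom_eq; rewrite /= mulmxA. Qed.

Fact rep_comp_linl U V W (f : rep_hom U V) :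
  linear (fun g : rep_hom V W => rep_comp g f).
Proof.
move=> a g h; apply: rep_hom_eq => /=.
by rewrite mulmxDl -scalemxAl.
Qed.

Fact rep_comp_linr U V W (g : rep_hom V W) :
  linear (fun f : rep_hom U V => rep_comp g f).
Proof.
move=> a f h; apply: rep_hom_eq => /=.
by rewrite mulmxDr -scalemxAr.
Qed.

Definition rep_lin : linCat K :=
  LinCat rep_comp1m rep_compm1 rep_compA rep_comp_linl rep_comp_linr.

Fact rep_unit_subproof : mx_repr G (fun _ => 1%:M : 'M[K]_1).
Proof. by split=> // x y _ _; rewrite mul1mx. Qed.

Definition rep_unit := RepOb (MxRepresentation rep_unit_subproof).

Fact rep_tens_subproof V W : mx_repr G (fun x => V x *t W x).
Proof.
split; first by rewrite !repr_mx1 tens1mx1.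
by move=> x y Gx Gy; rewrite !repr_mxM // tensmx_mul.
Qed.

Definition rep_tens V W := RepOb (MxRepresentation (rep_tens_subproof V W)).

Fact rep_tensm_subproof V V' W W' (f : rep_hom V V') (g : rep_hom W W') x :
  x \in G -> (vsval f *t vsval g) *m rep_tens V W x
             = rep_tens V' W' x *m (vsval f *t vsval g).
Proof. by move=> Gx; rewrite /= !tensmx_mul !rep_homP. Qed.

Definition rep_tensm V V' W W' (f : rep_hom V V') (g : rep_hom W W') :
    rep_hom (rep_tens V W) (rep_tens V' W') :=
  @rep_mor (rep_tens V W) (rep_tens V' W') _ (rep_tensm_subproof f g).

Fact rep_tensm_id V W :
  rep_tensm (rep_id V) (rep_id W) = rep_id (rep_tens V W).
Proof. by apply: rep_hom_eq; rewrite /= tens1mx1. Qed.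

Fact rep_tensm_comp V V' V'' W W' W''
    (f' : rep_hom V' V'') (f : rep_hom V V')
    (g' : rep_hom W' W'') (g : rep_hom W W') :
  rep_tensm (rep_comp f' f) (rep_comp g' g)
  = rep_comp (rep_tensm f' g') (rep_tensm f g).
Proof. by apply: rep_hom_eq; rewrite /= tensmx_mul. Qed.

Fact rep_tensm_linl V V' W W' (g : rep_hom W W') :
  linear (fun f : rep_hom V V' => rep_tensm f g).
Proof.
move=> a f h; apply: rep_hom_eq => /=.
by rewrite tensmxDl tensmxZl.
Qed.

Fact rep_tensm_linr V V' W W' (f : rep_hom V V') :
  linear (fun g : rep_hom W W' => rep_tensm f g).
Proof.
move=> a g h; apply: rep_hom_eq => /=.
by rewrite tensmxDr tensmxZr.
Qed.

Section Associativity.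
Variables U V W : rep_ob.

Fact rep_assoc_subproof x : x \in G ->
  pmx K (@assocf (rdim U) (rdim V) (rdim W)) *m rep_tens (rep_tens U V) W x
  = rep_tens U (rep_tens V W) x *m pmx K (@assocf _ _ _).
Proof. by move=> _; apply: assocf_nat. Qed.

Definition rep_assoc :
    rep_hom (rep_tens (rep_tens U V) W) (rep_tens U (rep_tens V W)) :=
  @rep_mor (rep_tens (rep_tens U V) W) (rep_tens U (rep_tens V W)) _
    rep_assoc_subproof.

Fact rep_assocV_subproof x : x \in G ->
  pmx K (@assocVf (rdim U) (rdim V) (rdim W)) *m rep_tens U (rep_tens V W) x
  = rep_tens (rep_tens U V) W x *m pmx K (@assocVf _ _ _).
Proof. by move=> _; apply: assocVf_nat. Qed.

Definition rep_assocV :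
    rep_hom (rep_tens U (rep_tens V W)) (rep_tens (rep_tens U V) W) :=
  @rep_mor (rep_tens U (rep_tens V W)) (rep_tens (rep_tens U V) W) _
    rep_assocV_subproof.

Fact rep_assoc_iso : @inverse_mors _ rep_lin _ _ rep_assoc rep_assocV.
Proof.
split; apply: rep_hom_eq => /=; apply: pmxK; first exact: assocfK.
exact: assocVfK.
Qed.

End Associativity.

Fact rep_assoc_nat U U' V V' W W'
    (f : rep_hom U U') (g : rep_hom V V') (h : rep_hom W W') :
  rep_comp (rep_assoc U' V' W') (rep_tensm (rep_tensm f g) h)
  = rep_comp (rep_tensm f (rep_tensm g h)) (rep_assoc U V W).
Proof. by apply: rep_hom_eq; apply: assocf_nat. Qed.

Section Units.
Variable V : rep_ob.

Fact rep_lunit_subproof x : x \in G ->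
  pmx K (@lunitf (rdim V)) *m rep_tens rep_unit V x
  = V x *m pmx K (@lunitf (rdim V)).
Proof. by move=> _; apply: lunitf_nat. Qed.

Definition rep_lunit : rep_hom (rep_tens rep_unit V) V :=
  @rep_mor (rep_tens rep_unit V) V _ rep_lunit_subproof.

Fact rep_lunitV_subproof x : x \in G ->
  pmx K (@lunitVf (rdim V)) *m V x
  = rep_tens rep_unit V x *m pmx K (@lunitVf (rdim V)).
Proof.
move=> Gx; rewrite -[LHS]mulmx1 -(pmxK K (@lunitVfK _)) mulmxA.
rewrite -[X in X *m _]mulmxA -(rep_lunit_subproof Gx) !mulmxA.
by rewrite (pmxK K (@lunitfK _)) mul1mx.
Qed.

Definition rep_lunitV : rep_hom V (rep_tens rep_unit V) :=
  @rep_mor V (rep_tens rep_unit V) _ rep_lunitV_subproof.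

Fact rep_lunit_iso : @inverse_mors _ rep_lin _ _ rep_lunit rep_lunitV.
Proof.
split; apply: rep_hom_eq => /=; apply: pmxK; first exact: lunitfK.
exact: lunitVfK.
Qed.

Fact rep_runit_subproof x : x \in G ->
  pmx K (@runitf (rdim V)) *m rep_tens V rep_unit x
  = V x *m pmx K (@runitf (rdim V)).
Proof. by move=> _; apply: runitf_nat. Qed.

Definition rep_runit : rep_hom (rep_tens V rep_unit) V :=
  @rep_mor (rep_tens V rep_unit) V _ rep_runit_subproof.

Fact rep_runitV_subproof x : x \in G ->
  pmx K (@runitVf (rdim V)) *m V x
  = rep_tens V rep_unit x *m pmx K (@runitVf (rdim V)).
Proof.
move=> Gx; rewrite -[LHS]mulmx1 -(pmxK K (@runitVfK _)) mulmxA.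
rewrite -[X in X *m _]mulmxA -(rep_runit_subproof Gx) !mulmxA.
by rewrite (pmxK K (@runitfK _)) mul1mx.
Qed.

Definition rep_runitV : rep_hom V (rep_tens V rep_unit) :=
  @rep_mor V (rep_tens V rep_unit) _ rep_runitV_subproof.

Fact rep_runit_iso : @inverse_mors _ rep_lin _ _ rep_runit rep_runitV.
Proof.
split; apply: rep_hom_eq => /=; apply: pmxK; first exact: runitfK.
exact: runitVfK.
Qed.

End Units.

Fact rep_lunit_nat V V' (f : rep_hom V V') :
  rep_comp (rep_lunit V') (rep_tensm (rep_id rep_unit) f)
  = rep_comp f (rep_lunit V).
Proof. by apply: rep_hom_eq; apply: lunitf_nat. Qed.

Fact rep_runit_nat V V' (f : rep_hom V V') :
  rep_comp (rep_runit V') (rep_tensm f (rep_id rep_unit))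
  = rep_comp f (rep_runit V).
Proof. by apply: rep_hom_eq; apply: runitf_nat. Qed.

Fact rep_pentagon U V W X :
  rep_comp (rep_comp (rep_tensm (rep_id U) (rep_assoc V W X))
                     (rep_assoc U (rep_tens V W) X))
           (rep_tensm (rep_assoc U V W) (rep_id X))
  = rep_comp (rep_assoc U V (rep_tens W X)) (rep_assoc (rep_tens U V) W X).
Proof.
apply: rep_hom_eq => /=.
rewrite -(pmx_id K (f := @id 'I_(rdim U))) // -(pmx_id K (f := @id 'I_(rdim X))) //.
rewrite !tens_pmx !pmx_comp; apply: eq_pmx => k /=.
case: (mxtens_indexP k) => k' l; case: (mxtens_indexP k') => k'' {}k.
by case: (mxtens_indexP k'') => i j; rewrite /tensf /assocf !mxtens_indexK.
Qed.

Fact rep_triangle U V :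
  rep_comp (rep_tensm (rep_id U) (rep_lunit V)) (rep_assoc U rep_unit V)
  = rep_tensm (rep_runit U) (rep_id V).
Proof.
apply: rep_hom_eq => /=.
rewrite -(pmx_id K (f := @id 'I_(rdim U))) // -(pmx_id K (f := @id 'I_(rdim V))) //.
rewrite !tens_pmx !pmx_comp; apply: eq_pmx => k /=.
case: (mxtens_indexP k) => k' l; case: (mxtens_indexP k') => i j.
by rewrite /tensf /assocf /lunitf /runitf !mxtens_indexK.
Qed.

Definition rep_mon : monCat K :=
  @MonCat K rep_lin rep_unit rep_tens rep_tensm rep_tensm_id rep_tensm_comp
    rep_tensm_linl rep_tensm_linr rep_assoc rep_assocV rep_assoc_iso
    rep_assoc_nat rep_lunit rep_lunitV rep_lunit_iso rep_lunit_nat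
    rep_runit rep_runitV rep_runit_iso rep_runit_nat rep_pentagon rep_triangle.

Variables (nu : gT) (nuZ : nu \in 'Z(G)%g) (nu2 : (nu * nu = 1)%g).

(* The projection onto the odd part, where nu acts as -1. *)
Definition odd_part V : 'M[K]_(rdim V) := 2^-1 *: (1%:M - V nu).

Lemma odd_part_idem V : odd_part V *m odd_part V = odd_part V.
Proof.
have Gnu : nu \in G by case/centerP: nuZ.
rewrite /odd_part -scalemxAl -scalemxAr mulmxBl mul1mx mulmxBr mulmx1.
rewrite -mxrepM // nu2 repr_mx1 opprB -mulr2n -scaler_nat !scalerA.
by rewrite -mulrA mulVf ?pnatr_eq0 // mulr1.
Qed.

Lemma odd_part_hom V W (f : rep_hom V W) :
  vsval f *m odd_part V = odd_part W *m vsval f.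
Proof.
have Gnu : nu \in G by case/centerP: nuZ.
rewrite /odd_part -scalemxAl -scalemxAr mulmxBl mulmxBr mul1mx mulmx1.
by rewrite rep_homP.
Qed.

Lemma odd_part_comm V x : x \in G -> odd_part V *m V x = V x *m odd_part V.
Proof.
move=> Gx; have [Gnu cnu] : nu \in G /\ centralises nu G by apply/centerP.
rewrite /odd_part -scalemxAl -scalemxAr mulmxBl mulmxBr mul1mx mulmx1.
by rewrite -!mxrepM // cnu.
Qed.

Lemma odd_part_tens V W :
  odd_part (rep_tens V W)
  = odd_part V *t 1%:M + 1%:M *t odd_part W
    - (odd_part V *t odd_part W) *+ 2.
Proof.
apply/matrixP=> i j; case: (mxtens_indexP i) => i1 i2.
case: (mxtens_indexP j) => j1 j2.
rewrite !mxE !mxtens_indexK (can_eq (@mxtens_indexK _ _)) xpair_eqE /= -mulnb.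
rewrite natrM; move: (_ == _)%:R (_ == _)%:R (V _ _ _) (W _ _ _) => a b v w.
by field.
Qed.

(* v (x) w |-> (-1)^(|v||w|) v (x) w on homogeneous vectors. *)
Definition koszul_sign V W : 'M[K]_(rdim V * rdim W) :=
  1%:M - (odd_part V *t odd_part W) *+ 2.

Lemma mulmx_reflection n (P Q : 'M[K]_n) :
  (1%:M - P *+ 2) *m (1%:M - Q *+ 2)
  = 1%:M - (P + Q - (P *m Q) *+ 2) *+ 2.
Proof.
rewrite mulmxBl mul1mx mulmxBr mulmx1 -!scaler_nat -!scalemxAl -!scalemxAr.
by apply/matrixP=> i j; rewrite !mxE; ring.
Qed.

Lemma koszul_signK V W : koszul_sign V W *m koszul_sign V W = 1%:M.
Proof.
by rewrite mulmx_reflection tensmx_mul !odd_part_idem -mulr2n subrr mul0rn subr0.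
Qed.

Lemma koszul_sign_nat V V' W W' (f : rep_hom V V') (g : rep_hom W W') :
  koszul_sign V' W' *m (vsval f *t vsval g)
  = (vsval f *t vsval g) *m koszul_sign V W.
Proof.
rewrite mulmxBl mulmxBr mul1mx mulmx1 -!scaler_nat -scalemxAl -scalemxAr.
by rewrite !tensmx_mul !odd_part_hom.
Qed.

Lemma koszul_swap V W :
  koszul_sign W V *m pmx K (@swapf (rdim V) (rdim W))
  = pmx K (@swapf (rdim V) (rdim W)) *m koszul_sign V W.
Proof.
rewrite mulmxBl mulmxBr mul1mx mulmx1 -!scaler_nat -scalemxAl -scalemxAr.
by rewrite swapf_nat.
Qed.

Fact rep_brd_subproof V W x : x \in G ->
  (pmx K (@swapf (rdim V) (rdim W)) *m koszul_sign V W) *m rep_tens V W x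
  = rep_tens W V x *m (pmx K (@swapf (rdim V) (rdim W)) *m koszul_sign V W).
Proof.
move=> Gx; rewrite /= [RHS]mulmxA -swapf_nat -!mulmxA; congr (_ *m _).
rewrite mulmxBl mulmxBr mul1mx mulmx1 -!scaler_nat -scalemxAl -scalemxAr.
by rewrite !tensmx_mul !odd_part_comm.
Qed.

Definition rep_brd V W : rep_hom (rep_tens V W) (rep_tens W V) :=
  @rep_mor (rep_tens V W) (rep_tens W V) _ (@rep_brd_subproof V W).

Lemma rep_brdK V W : rep_comp (rep_brd W V) (rep_brd V W) = rep_id _.
Proof.
apply: rep_hom_eq; rewrite /= mulmxA -[X in X *m _]mulmxA koszul_swap.
by rewrite mulmxA (pmxK K (@swapfK _ _)) mul1mx koszul_signK.
Qed.

Fact rep_brd_iso V W : @iso_mor _ rep_lin _ _ (rep_brd V W).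
Proof. by exists (rep_brd W V); split; apply: rep_brdK. Qed.

Fact rep_brd_nat V V' W W' (f : rep_hom V V') (g : rep_hom W W') :
  rep_comp (rep_brd V' W') (rep_tensm f g)
  = rep_comp (rep_tensm g f) (rep_brd V W).
Proof.
apply: rep_hom_eq; rewrite /= -mulmxA koszul_sign_nat !mulmxA.
by rewrite swapf_nat.
Qed.

Fact rep_hexagon1 U V W :
  rep_comp (rep_comp (rep_assoc V W U) (rep_brd U (rep_tens V W)))
           (rep_assoc U V W)
  = rep_comp (rep_comp (rep_tensm (rep_id V) (rep_brd U W)) (rep_assoc V U W))
             (rep_tensm (rep_brd U V) (rep_id W)).
Proof.
apply: rep_hom_eq => /=.
pose k12 := koszul_sign U V *t (1%:M : 'M_(rdim W)).
pose k13 := 1%:M - ((odd_part U *t (1%:M : 'M_(rdim V))) *t odd_part W) *+ 2.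
have kl : koszul_sign U (rep_tens V W) *m pmx K (@assocf _ _ _)
          = pmx K (@assocf _ _ _) *m (k13 *m k12).
  have -> : k12 = 1%:M - (odd_part U *t odd_part V *t 1%:M) *+ 2.
    rewrite /k12 /koszul_sign -scaler_nat -scaleNr tensmxDl tensmxZl tens1mx1.
    by rewrite scaleNr scaler_nat.
  rewrite mulmx_reflection !tensmx_mul odd_part_idem !(mulmx1, mul1mx).
  rewrite mulmxBl mulmxBr mul1mx mulmx1 odd_part_tens; congr (_ - _).
  rewrite -!scaler_nat -scalemxAl -scalemxAr; congr (_ *: _).
  rewrite -!scaleNr !tensmxDr (tensmxZr (- 2)) !mulmxDl !mulmxDr -scalemxAl.
  rewrite -[X in _ = _ + X]scalemxAr.
  by rewrite -!assocf_nat [X in X + _ = _]addrC.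
have kr : ((1%:M : 'M_(rdim V)) *t koszul_sign U W) *m pmx K (@assocf _ _ _)
            *m (pmx K (@swapf _ _) *t 1%:M)
          = pmx K (@assocf _ _ _) *m (pmx K (@swapf _ _) *t 1%:M) *m k13.
  rewrite /koszul_sign -scaler_nat -scaleNr tensmxDr tensmxZr tens1mx1.
  rewrite scaleNr scaler_nat !mulmxBl mulmxBr mul1mx mulmx1; congr (_ - _).
  rewrite -!scaler_nat -!scalemxAl -scalemxAr -assocf_nat -!mulmxA.
  by rewrite !tensmx_mul swapf_nat mul1mx mulmx1.
have tM : (1%:M : 'M_(rdim V)) *t (pmx K (@swapf _ _) *m koszul_sign U W)
    = (1%:M *t pmx K (@swapf _ _)) *m (1%:M *t koszul_sign U W).
  by rewrite tensmx_mul mul1mx.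
have Mt : (pmx K (@swapf _ _) *m koszul_sign U V) *t (1%:M : 'M_(rdim W))
    = (pmx K (@swapf _ _) *t 1%:M) *m k12.
  by rewrite tensmx_mul mul1mx.
rewrite tM Mt -!mulmxA kl !mulmxA; congr (_ *m k12).
rewrite -[in RHS]mulmxA -[in RHS]mulmxA [X in _ = _ *m X]mulmxA kr !mulmxA.
congr (_ *m k13).
rewrite -(pmx_id K (f := @id 'I_(rdim V))) // -(pmx_id K (f := @id 'I_(rdim W))) //.
rewrite !tens_pmx !pmx_comp; apply: eq_pmx => k /=.
case: (mxtens_indexP k) => k' l; case: (mxtens_indexP k') => i j.
by rewrite /tensf /assocf /swapf !mxtens_indexK.
Qed.

Fact rep_hexagon2 U V W :
  rep_comp (rep_comp (rep_assocV W U V) (rep_brd (rep_tens U V) W))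
           (rep_assocV U V W)
  = rep_comp (rep_comp (rep_tensm (rep_brd U W) (rep_id V)) (rep_assocV U W V))
             (rep_tensm (rep_id U) (rep_brd V W)).
Proof.
have invC X Y (f : rep_hom X Y) (g : rep_hom Y X) :
    rep_comp f g = rep_id _ ->
    forall Z (h : rep_hom Z Y), rep_comp f (rep_comp g h) = h.
  by move=> fg Z h; rewrite rep_compA fg rep_comp1m.
have aK X Y Z : rep_comp (rep_assocV X Y Z) (rep_assoc X Y Z) = rep_id _ :=
  (rep_assoc_iso X Y Z).1.
have aVK X Y Z : rep_comp (rep_assoc X Y Z) (rep_assocV X Y Z) = rep_id _ :=
  (rep_assoc_iso X Y Z).2.
have bl X Y Z : rep_comp (rep_tensm (rep_brd X Y) (rep_id Z))
    (rep_tensm (rep_brd Y X) (rep_id Z)) = rep_id _.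
  by rewrite -rep_tensm_comp rep_brdK rep_comp1m rep_tensm_id.
have br X Y Z : rep_comp (rep_tensm (rep_id Z) (rep_brd X Y))
    (rep_tensm (rep_id Z) (rep_brd Y X)) = rep_id _.
  by rewrite -rep_tensm_comp rep_brdK rep_comp1m rep_tensm_id.
set lhs := LHS; set rhs := RHS.
have := rep_hexagon1 W U V; set lhs' := LHS; set rhs' := RHS => hex.
have lK : rep_comp lhs lhs' = rep_id _.
  rewrite /lhs /lhs' -!rep_compA (invC _ _ _ _ (aK _ _ _)).
  by rewrite (invC _ _ _ _ (rep_brdK _ _)) aK.
have rK : rep_comp rhs' rhs = rep_id _.
  rewrite /rhs /rhs' -!rep_compA (invC _ _ _ _ (bl _ _ _)).
  by rewrite (invC _ _ _ _ (aVK _ _ _)) br.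
by rewrite -[lhs]rep_compm1 -rK rep_compA -hex lK rep_comp1m.
Qed.

Definition rep_braiding : braiding rep_mon :=
  @Braiding K rep_mon rep_brd rep_brd_iso rep_brd_nat rep_hexagon1 rep_hexagon2.

End Representations.

(* Super-Tannakian: braided equivalent to Rep(G, nu) for some nu <> 1. The full
   replete subcategory P carries the restricted braiding c; the conjunct nu <> 1
   is what excludes the Tannakian case. *)
Definition super_tannakian (K : numFieldType) (M : monCat K) (c : braiding M)
    (P : M -> Prop) :=
  exists (gT : finGroupType) (G : {group gT}) (nu : gT)
    (nuZ : nu \in 'Z(G)%g) (nu2 : (nu * nu = 1)%g),
  nu <> 1%g /\
  exists F : braidedFunctor (rep_braiding K nuZ nu2) c, equivalence_onto F P.

(* Main.v *)
(* Write [u] for the Drinfeld morphism, [psi] for the spherical structure and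
   [M X Y] for the double braiding. The inverse twist [w := psi^-1 u] is
   natural and satisfies [w (X (x) Y) M X Y = w X (x) w Y]. For [X] in [D] the
   object [X (x) rho] is a multiple of [rho], so [w] is the same scalar [s] on
   both and [M X rho = w X (x) rho]. Comparing [M X (Y (x) rho)] with
   [M X rho] gives [M X Y = 1] for [X], [Y] in [D].
   If [rho] occurs in [rho (x) rho], then [w X * w X = w X], hence [w X = 1]
   and the trace of [u X] is [FPdim X >= 0] for every [X] in [D]; but this
   trace is [- dim V] on the image of a representation [V] where [nu] acts by
   [-1]. Otherwise [rho (x) rho] is in [D], and [e := w (rho (x) rho)] is an
   involution with [M rho rho = s^2 e]. On [rho (x) rho (x) rho], with [e1], [e2]
   the two copies of [e] and [t] the braiding of the last two factors, the
   hexagon axioms turn [M (rho (x) rho) rho = e1] into [e1 = s^2 t e1 t], where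
   [t^2 = s^2 e2]; this forces [s^16 = 1].

   To avoid associators, morphisms [X (x) Y -> X' (x) Y'] are replaced by the
   families [X (x) (Y (x) Z) -> X' (x) (Y' (x) Z)], natural in [Z]. *)
From HB Require Import structures.
Require Import Defs.
From mathcomp Require Import all_boot all_order all_algebra all_fingroup.
From mathcomp Require Import all_solvable mxrepresentation ring.
From mathcomp Require Import boolp reals complex mxtens.
(* [ssrfun.compA] and [morphism.idm] would shadow those of [Defs]. *)
Import Defs.

Set Implicit Arguments.
Unset Strict Implicit.
Unset Printing Implicit Defensive.

Import Order.TTheory GRing.Theory Num.Theory VectorInternalTheory.
Local Open Scope ring_scope.

Notation "X ◁ f" := (idm X \om f) (at level 40, left associativity) : ring_scope.
Notation "f ▷ X" := (f \om idm X) (at level 40, left associativity) : ring_scope.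

Lemma scalar_inj (K : fieldType) (V : lmodType K) (v : V) :
  v != 0 -> injective (fun a : K => a *: v).
Proof.
move=> nzv a b /eqP; rewrite -subr_eq0 -scalerBl scaler_eq0 (negbTE nzv) orbF.
by rewrite subr_eq0 => /eqP.
Qed.

(** * Bilinear composition in linear categories *)

Section LinearCalculus.
Variables (K : fieldType) (C : linCat K).
Implicit Types V X Y Z W : C.

Lemma comp_reassoc X Y Z W (g : mor Y Z) (f : mor X Y) (h : mor X Z)
    (k : mor W X) : g \oc f = h -> g \oc (f \oc k) = h \oc k.
Proof. by move=> <-; rewrite compA. Qed.

Lemma comp_reassoc3 V X Y Z W (h : mor Z V) (g : mor Y Z) (f : mor X Y)
    (e : mor X V) (k : mor W X) :
  h \oc (g \oc f) = e -> h \oc (g \oc (f \oc k)) = e \oc k.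
Proof. by move=> <-; rewrite !compA. Qed.

Lemma compDm X Y Z (f : mor X Y) (g h : mor Y Z) :
  (g + h) \oc f = (g \oc f) + (h \oc f).
Proof. by have := comp_linl f 1 g h; rewrite !scale1r. Qed.

Lemma compmD X Y Z (f : mor Y Z) (g h : mor X Y) :
  f \oc (g + h) = (f \oc g) + (f \oc h).
Proof. by have := comp_linr f 1 g h; rewrite !scale1r. Qed.

Lemma comp0m X Y Z (f : mor X Y) : (0 : mor Y Z) \oc f = 0.
Proof. by apply: (@addIr _ (0 \oc f)); rewrite -compDm !add0r. Qed.

Lemma compm0 X Y Z (f : mor Y Z) : f \oc (0 : mor X Y) = 0.
Proof. by apply: (@addIr _ (f \oc 0)); rewrite -compmD !add0r. Qed.

Lemma compZm X Y Z a (f : mor X Y) (g : mor Y Z) : (a *: g) \oc f = a *: (g \oc f).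
Proof. by have := comp_linl f a g 0; rewrite comp0m !addr0. Qed.

Lemma compmZ X Y Z a (f : mor Y Z) (g : mor X Y) : f \oc (a *: g) = a *: (f \oc g).
Proof. by have := comp_linr f a g 0; rewrite compm0 !addr0. Qed.

Lemma compBm X Y Z (f : mor X Y) (g h : mor Y Z) :
  (g - h) \oc f = (g \oc f) - (h \oc f).
Proof. by rewrite compDm -scaleN1r compZm scaleN1r. Qed.

Lemma compmB X Y Z (f : mor Y Z) (g h : mor X Y) :
  f \oc (g - h) = (f \oc g) - (f \oc h).
Proof. by rewrite compmD -scaleN1r compmZ scaleN1r. Qed.

Lemma comp_suml X Y Z n (f : mor X Y) (g : 'I_n -> mor Y Z) :
  (\sum_i g i) \oc f = \sum_i (g i \oc f).
Proof. by apply: (big_morph (fun g => g \oc f)) => [u v|]; rewrite (compDm, comp0m). Qed.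

Lemma comp_sumr X Y Z n (f : mor Y Z) (g : 'I_n -> mor X Y) :
  f \oc (\sum_i g i) = \sum_i (f \oc g i).
Proof. by apply: (big_morph (fun g => f \oc g)) => [u v|]; rewrite (compmD, compm0). Qed.

Lemma split_epiP X Y Z (f : mor X Y) (f' : mor Y X) (g h : mor Y Z) :
  f \oc f' = idm Y -> g \oc f = h \oc f -> g = h.
Proof. by move=> fK gh; rewrite -[g]compm1 -[h]compm1 -fK !compA gh. Qed.

Lemma split_monoP X Y Z (f : mor X Y) (f' : mor Y X) (g h : mor Z X) :
  f' \oc f = idm X -> f \oc g = f \oc h -> g = h.
Proof. by move=> fK gh; rewrite -[g]comp1m -[h]comp1m -fK -!compA gh. Qed.

End LinearCalculus.

(** * Monoidal calculus without associators *)

HB.lock Definition lift2 (K : fieldType) (C : monCat K) (X Y X' Y' : C)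
    (f : mor (X \ox Y) (X' \ox Y')) (Z : C) :
    mor (X \ox (Y \ox Z)) (X' \ox (Y' \ox Z)) :=
  assoc X' Y' Z \oc (f ▷ Z) \oc assocV X Y Z.
Arguments lift2 {K C X Y X' Y'} f Z.

(** The counterparts of [lift2] for pairings and copairings, here and in [cup], absorb the unit
    constraint too. Locking keeps the associators from resurfacing during rewriting. *)
HB.lock Definition cap (K : fieldType) (C : monCat K) (A B : C)
    (p : mor (A \ox B) unit_ob) (Z : C) : mor (A \ox (B \ox Z)) Z :=
  lunit Z \oc (p ▷ Z) \oc assocV A B Z.
Arguments cap {K C A B} p Z.

HB.lock Definition cup (K : fieldType) (C : monCat K) (A B : C)
    (q : mor unit_ob (A \ox B)) (Z : C) : mor Z (A \ox (B \ox Z)) :=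
  assoc A B Z \oc (q ▷ Z) \oc lunitV Z.
Arguments cup {K C A B} q Z.

Section MonoidalCalculus.
Variables (K : fieldType) (C : monCat K).
Implicit Types X Y Z W A B : C.

Lemma tens0m X X' Y Y' (g : mor Y Y') : (0 : mor X X') \om g = 0.
Proof.
apply: (@addIr _ (0 \om g)).
by have := tensm_linl g 1 (0 : mor X X') 0; rewrite !scale1r !add0r => <-.
Qed.

Lemma tensm0 X X' Y Y' (f : mor X X') : f \om (0 : mor Y Y') = 0.
Proof.
apply: (@addIr _ (f \om 0)).
by have := tensm_linr f 1 (0 : mor Y Y') 0; rewrite !scale1r !add0r => <-.
Qed.

Lemma tensZm X X' Y Y' a (f : mor X X') (g : mor Y Y') :
  (a *: f) \om g = a *: (f \om g).
Proof. by have := tensm_linl g a f 0; rewrite tens0m !addr0. Qed.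

Lemma tensmZ X X' Y Y' a (f : mor X X') (g : mor Y Y') :
  f \om (a *: g) = a *: (f \om g).
Proof. by have := tensm_linr f a g 0; rewrite tensm0 !addr0. Qed.

Lemma tensm_sum X X' Y Y' n (f : mor X X') (g : 'I_n -> mor Y Y') :
  f \om (\sum_i g i) = \sum_i (f \om g i).
Proof.
apply: (big_morph (fun g => f \om g)) => [u v|]; last exact: tensm0.
by have := tensm_linr f 1 u v; rewrite !scale1r.
Qed.

Lemma wl_comp X Y Z W (g : mor Z W) (f : mor Y Z) :
  X ◁ (g \oc f) = (X ◁ g) \oc (X ◁ f).
Proof. by rewrite -tensm_comp comp1m. Qed.

Lemma wr_comp X Y Z W (g : mor Z W) (f : mor Y Z) :
  (g \oc f) ▷ X = (g ▷ X) \oc (f ▷ X).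
Proof. by rewrite -tensm_comp comp1m. Qed.

Lemma wr_wl X X' Y Y' (f : mor X X') (g : mor Y Y') :
  (f ▷ Y') \oc (X ◁ g) = f \om g.
Proof. by rewrite -tensm_comp comp1m compm1. Qed.

Lemma wl_wr X X' Y Y' (f : mor X X') (g : mor Y Y') :
  (X' ◁ g) \oc (f ▷ Y) = f \om g.
Proof. by rewrite -tensm_comp comp1m compm1. Qed.

Lemma exchange X X' Y Y' (f : mor X X') (g : mor Y Y') :
  (f ▷ Y') \oc (X ◁ g) = (X' ◁ g) \oc (f ▷ Y).
Proof. by rewrite wr_wl wl_wr. Qed.

Lemma assocK X Y Z : assocV X Y Z \oc assoc X Y Z = idm _.
Proof. by case: (assoc_iso X Y Z). Qed.
Lemma assocVK X Y Z : assoc X Y Z \oc assocV X Y Z = idm _.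
Proof. by case: (assoc_iso X Y Z). Qed.
Lemma lunitK X : lunitV X \oc lunit X = idm _.
Proof. by case: (lunit_iso X). Qed.
Lemma lunitVK X : lunit X \oc lunitV X = idm _.
Proof. by case: (lunit_iso X). Qed.
Lemma runitK X : runitV X \oc runit X = idm _.
Proof. by case: (runit_iso X). Qed.
Lemma runitVK X : runit X \oc runitV X = idm _.
Proof. by case: (runit_iso X). Qed.

Lemma assocV_nat X X' Y Y' Z Z' (f : mor X X') (g : mor Y Y') (h : mor Z Z') :
  assocV X' Y' Z' \oc (f \om (g \om h)) = (f \om g \om h) \oc assocV X Y Z.
Proof.
apply: (split_monoP (assocK X' Y' Z')); rewrite compA assocVK comp1m.
by rewrite compA assoc_nat -compA assocVK compm1.
Qed.

Lemma lunitV_nat X X' (f : mor X X') :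
  lunitV X' \oc f = (unit_ob ◁ f) \oc lunitV X.
Proof.
apply: (split_monoP (lunitK X')); rewrite compA lunitVK comp1m.
by rewrite compA lunit_nat -compA lunitVK compm1.
Qed.

Lemma wl_unit_inj X Y (f g : mor X Y) : unit_ob ◁ f = unit_ob ◁ g -> f = g.
Proof.
by move=> fg; apply: (split_epiP (lunitVK X)); rewrite -!lunit_nat fg.
Qed.

Lemma wr_unit_inj X Y (f g : mor X Y) : f ▷ unit_ob = g ▷ unit_ob -> f = g.
Proof.
by move=> fg; apply: (split_epiP (runitVK X)); rewrite -!runit_nat fg.
Qed.

Lemma wrA X Y (f : mor X Y) Z W :
  assoc Y Z W \oc ((f ▷ Z) ▷ W) = (f ▷ (Z \ox W)) \oc assoc X Z W.
Proof. by rewrite assoc_nat tensm_id. Qed.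

Lemma wlA X Y (f : mor X Y) Z W :
  assoc Z W Y \oc ((Z \ox W) ◁ f) = (Z ◁ (W ◁ f)) \oc assoc Z W X.
Proof. by rewrite -tensm_id assoc_nat. Qed.

Lemma wlr_assoc X Y (f : mor X Y) Z W :
  assoc Z Y W \oc ((Z ◁ f) ▷ W) = (Z ◁ (f ▷ W)) \oc assoc Z X W.
Proof. exact: assoc_nat. Qed.

(** Kelly's coherence argument: tensoring with the unit is faithful, and after it the pentagon with
    two unit factors reduces the claim to the triangle axiom. *)
Lemma lunit_tens Y Z : lunit (Y \ox Z) \oc assoc unit_ob Y Z = lunit Y ▷ Z.
Proof.
apply: wl_unit_inj; rewrite wl_comp.
apply: (split_epiP (assocVK unit_ob (unit_ob \ox Y) Z)).
apply: (@split_epiP _ _ _ _ _ (assoc unit_ob unit_ob Y ▷ Z)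
   (assocV unit_ob unit_ob Y ▷ Z)).
  by rewrite -wr_comp assocVK tensm_id.
have /= P := pentagon unit_ob unit_ob Y Z.
rewrite -!compA; rewrite -!compA in P; rewrite P.
rewrite compA triangle -wrA -triangle wr_comp compA wlr_assoc -!compA.
by [].
Qed.

Lemma pentagonV W X Y Z :
  assoc W (X \ox Y) Z \oc (assoc W X Y ▷ Z)
  = (W ◁ assocV X Y Z) \oc (assoc W X (Y \ox Z) \oc assoc (W \ox X) Y Z).
Proof.
rewrite -pentagon -compA compA -wl_comp assocK tensm_id comp1m. by [].
Qed.

Lemma assoc_lift2 X Y X' Y' (f : mor (X \ox Y) (X' \ox Y')) Z :
  assoc X' Y' Z \oc (f ▷ Z) = lift2 f Z \oc assoc X Y Z.
Proof. by rewrite lift2.unlock -!compA assocK compm1. Qed.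

Lemma lift2_nat X Y X' Y' (f : mor (X \ox Y) (X' \ox Y')) Z Z' (h : mor Z Z') :
  (X' ◁ (Y' ◁ h)) \oc lift2 f Z = lift2 f Z' \oc (X ◁ (Y ◁ h)).
Proof.
rewrite lift2.unlock -!compA assocV_nat tensm_id.
rewrite [in RHS](comp_reassoc _ (exchange _ _)) -!compA.
by rewrite (comp_reassoc _ (wlA _ _ _)) -!compA.
Qed.

Lemma lift2_comp X Y X' Y' X'' Y'' (g : mor (X' \ox Y') (X'' \ox Y''))
   (f : mor (X \ox Y) (X' \ox Y')) Z : lift2 (g \oc f) Z = lift2 g Z \oc lift2 f Z.
Proof.
by rewrite lift2.unlock wr_comp -!compA (comp_reassoc _ (assocK _ _ _)) comp1m.
Qed.

Lemma lift2_id X Y Z : lift2 (idm (X \ox Y)) Z = idm _.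
Proof. by rewrite lift2.unlock tensm_id compm1 assocVK. Qed.

Lemma lift2Z X Y X' Y' a (f : mor (X \ox Y) (X' \ox Y')) Z :
  lift2 (a *: f) Z = a *: lift2 f Z.
Proof. by rewrite lift2.unlock tensZm !(compZm, compmZ). Qed.

Lemma lift2_wr X X' Y (f : mor X X') Z : lift2 (f ▷ Y) Z = f ▷ (Y \ox Z).
Proof. by rewrite lift2.unlock wrA -compA assocVK compm1. Qed.

Lemma lift2_wl X Y Y' (f : mor Y Y') Z : lift2 (X ◁ f) Z = X ◁ (f ▷ Z).
Proof. by rewrite lift2.unlock wlr_assoc -compA assocVK compm1. Qed.

(** The member of the family at the unit already determines the morphism, since [- ▷ unit_ob] is
    faithful. *)
Lemma lift2_inj X Y X' Y' (f g : mor (X \ox Y) (X' \ox Y')) :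
  lift2 f unit_ob = lift2 g unit_ob -> f = g.
Proof.
move=> fg; apply: wr_unit_inj; apply: (split_monoP (assocK _ _ _)).
by rewrite !assoc_lift2 fg.
Qed.

Lemma cap_nat A B (p : mor (A \ox B) unit_ob) Z Z' (h : mor Z Z') :
  h \oc cap p Z = cap p Z' \oc (A ◁ (B ◁ h)).
Proof.
rewrite cap.unlock -!compA assocV_nat tensm_id.
rewrite [in RHS](comp_reassoc _ (exchange _ _)) -!compA.
by rewrite [in RHS](comp_reassoc _ (lunit_nat _)) -!compA.
Qed.

Lemma cup_nat A B (q : mor unit_ob (A \ox B)) Z Z' (h : mor Z Z') :
  cup q Z' \oc h = (A ◁ (B ◁ h)) \oc cup q Z.
Proof.
rewrite cup.unlock -!compA lunitV_nat.
rewrite [in LHS](comp_reassoc _ (exchange _ _)) -!compA.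
by rewrite [in LHS](comp_reassoc _ (wlA _ _ _)) -!compA.
Qed.

Lemma cap_assoc A B (p : mor (A \ox B) unit_ob) Z :
  cap p Z \oc assoc A B Z = lunit Z \oc (p ▷ Z).
Proof. by rewrite cap.unlock -!compA assocK compm1. Qed.

Lemma cap_inj A B (p q : mor (A \ox B) unit_ob) :
  cap p unit_ob = cap q unit_ob -> p = q.
Proof.
move=> pq; apply: wr_unit_inj; apply: (split_monoP (lunitK _)).
by rewrite -!cap_assoc pq.
Qed.

Lemma cap_comp A B A' B' (p : mor (A' \ox B') unit_ob)
   (f : mor (A \ox B) (A' \ox B')) Z : cap (p \oc f) Z = cap p Z \oc lift2 f Z.
Proof.
by rewrite cap.unlock lift2.unlock wr_comp -!compA (comp_reassoc _ (assocK _ _ _)) comp1m.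
Qed.

Lemma cap_wl A B B' (p : mor (A \ox B') unit_ob) (f : mor B B') Z :
  cap (p \oc (A ◁ f)) Z = cap p Z \oc (A ◁ (f ▷ Z)).
Proof.
by rewrite cap_comp lift2_wl.
Qed.

Lemma cap_wr A A' B (p : mor (A' \ox B) unit_ob) (f : mor A A') Z :
  cap (p \oc (f ▷ B)) Z = cap p Z \oc (f ▷ (B \ox Z)).
Proof. by rewrite cap_comp lift2_wr. Qed.

Lemma cap_cup A B (p : mor (A \ox B) unit_ob) (q : mor unit_ob (A \ox B)) Z :
  cap p Z \oc cup q Z = lunit Z \oc ((p \oc q) ▷ Z) \oc lunitV Z.
Proof.
by rewrite cup.unlock 2!compA cap_assoc wr_comp !compA.
Qed.

End MonoidalCalculus.

(** * Duals, zigzags and transposition *)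

Section Duality.
Variables (K : fieldType) (C : monCat K).
Implicit Types X Y Z W A B : C.

(** At [q = coev (dualP X)] this is convertible to [transpose]; a general [q] allows the comparison
    of two duals in [half_dual_loop]. *)
Definition transp A X Xd (p : mor (A \ox X) unit_ob) (q : mor unit_ob (X \ox Xd)) :
    mor A Xd :=
  lunit Xd \oc (p ▷ Xd) \oc assocV A X Xd \oc (A ◁ q) \oc runitV A.

Lemma pentagonVV W X Y Z :
  assoc (W \ox X) Y Z \oc (assocV W X Y ▷ Z)
  = assocV W X (Y \ox Z) \oc ((W ◁ assoc X Y Z) \oc assoc W (X \ox Y) Z).
Proof.
apply: (split_monoP (assocK _ _ _)); rewrite [RHS]compA assocVK comp1m.
by rewrite compA -pentagon -compA -wr_comp assocVK tensm_id compm1.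
Qed.

Lemma assoc_runitV A Z :
  assoc A unit_ob Z \oc (runitV A ▷ Z) = A ◁ lunitV Z.
Proof.
apply: (@split_monoP _ _ _ _ _ (A ◁ lunit Z) (A ◁ lunitV Z)).
  by rewrite -wl_comp lunitK tensm_id.
by rewrite compA triangle -wr_comp runitVK -wl_comp lunitVK !tensm_id.
Qed.

Lemma transp_wr A X Xd (p : mor (A \ox X) unit_ob) (q : mor unit_ob (X \ox Xd)) Z :
  transp p q ▷ Z = cap p (Xd \ox Z) \oc (A ◁ cup q Z).
Proof.
rewrite /transp !wr_comp -lunit_tens -!compA.
rewrite (comp_reassoc _ (wrA _ _ _)) -!compA.
rewrite (comp_reassoc _ (pentagonVV _ _ _ _)) -!compA.
rewrite (comp_reassoc _ (wlr_assoc _ _ _)) -!compA assoc_runitV.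
by rewrite cap.unlock cup.unlock !wl_comp -!compA.
Qed.

Lemma lunitV_tens Y Z :
  assoc unit_ob Y Z \oc (lunitV Y ▷ Z) = lunitV (Y \ox Z).
Proof.
apply: (split_monoP (lunitK _)).
by rewrite compA lunit_tens -wr_comp !lunitVK tensm_id.
Qed.

(** This is the zigzag identity that fixes the value of the loop [p \oc brd \oc q]; it can be
    checked on matrices and carried along a braided functor. *)
Definition half_dual X Xd (p : mor (Xd \ox X) unit_ob) (q : mor unit_ob (X \ox Xd)) :=
  runit X \oc (X ◁ p) \oc assoc X Xd X \oc (q ▷ X) \oc lunitV X = idm X.

Lemma half_dual_cap_cup X Xd (p : mor (Xd \ox X) unit_ob)
    (q : mor unit_ob (X \ox Xd)) Z :
  half_dual p q -> (X ◁ cap p Z) \oc cup q (X \ox Z) = idm _.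
Proof.
move=> pq; rewrite -[RHS]tensm_id -[in RHS]pq !wr_comp -triangle -!compA.
rewrite (comp_reassoc _ (wlr_assoc _ _ _)) -!compA.
rewrite [in RHS](comp_reassoc _ (pentagonV _ _ _ _)) -!compA.
rewrite [in RHS](comp_reassoc _ (wrA _ _ _)) -!compA lunitV_tens.
by rewrite cap.unlock cup.unlock !wl_comp -!compA.
Qed.

Section Zigzag.
Variables (X Xd : C) (d : duality X Xd).

Lemma zigzag1Z Z : (X ◁ cap (ev d) Z) \oc cup (coev d) (X \ox Z) = idm _.
Proof. exact/half_dual_cap_cup/zigzag1. Qed.

Lemma zigzag2Z Z : cap (ev d) (Xd \ox Z) \oc (Xd ◁ cup (coev d) Z) = idm _.
Proof. by rewrite -transp_wr /transp zigzag2 tensm_id. Qed.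

(** Universal property of the dual: the cup inside [transp] is straightened against the cap by the
    first zigzag. *)
Lemma cap_transp A (p : mor (A \ox X) unit_ob) Z :
  cap (ev d) Z \oc (transp p (coev d) ▷ (X \ox Z)) = cap p Z.
Proof.
rewrite transp_wr compA (cap_nat p) -compA -wl_comp zigzag1Z.
by rewrite tensm_id compm1.
Qed.

Lemma ev_transp A (p : mor (A \ox X) unit_ob) :
  ev d \oc (transp p (coev d) ▷ X) = p.
Proof. by apply: cap_inj; rewrite cap_wr cap_transp. Qed.

(** The second zigzag recovers a morphism into a dual from its pairing, so equations between such
    morphisms can be checked under [cap]. *)
Lemma pairing_inj A (f g : mor A Xd) :
  (forall Z, cap (ev d) Z \oc (f ▷ (X \ox Z)) = cap (ev d) Z \oc (g ▷ (X \ox Z))) ->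
  f = g.
Proof.
move=> fg; apply: wr_unit_inj.
have E h : h ▷ unit_ob
    = cap (ev d) (Xd \ox unit_ob) \oc (h ▷ _) \oc (A ◁ cup (coev d) unit_ob).
  by rewrite -compA exchange compA zigzag2Z comp1m.
by rewrite E fg -E.
Qed.

End Zigzag.

End Duality.

(** * Hexagons, Yang-Baxter equation and double braiding *)

Section Braiding.
Variables (K : fieldType) (C : monCat K) (c : braiding C).
Implicit Types X Y Z W A B : C.

Definition bz X Y Z : mor (X \ox (Y \ox Z)) (Y \ox (X \ox Z)) := lift2 (brd c X Y) Z.

Lemma bz_nat X Y Z Z' (h : mor Z Z') :
  (Y ◁ (X ◁ h)) \oc bz X Y Z = bz X Y Z' \oc (X ◁ (Y ◁ h)).
Proof. exact: lift2_nat. Qed.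

Lemma bz_natl X X' Y Z (f : mor X X') :
  bz X' Y Z \oc (f ▷ (Y \ox Z)) = (Y ◁ (f ▷ Z)) \oc bz X Y Z.
Proof.
by rewrite -lift2_wr -lift2_comp brd_nat lift2_comp lift2_wl.
Qed.

Lemma bz_natr X Y Y' Z (f : mor Y Y') :
  bz X Y' Z \oc (X ◁ (f ▷ Z)) = (f ▷ (X \ox Z)) \oc bz X Y Z.
Proof.
by rewrite -[in RHS]lift2_wr -lift2_comp -brd_nat lift2_comp lift2_wl.
Qed.

(** The first hexagon for families; three pentagons bring it to the form of the axiom. *)
Lemma bz_tensr X Y W Z :
  assoc Y W (X \ox Z) \oc bz X (Y \ox W) Z
  = (Y ◁ bz X W Z) \oc (bz X Y (W \ox Z) \oc (X ◁ assoc Y W Z)).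
Proof.
apply: (@split_epiP _ _ _ _ _ (assoc X (Y \ox W) Z \oc (assoc X Y W ▷ Z))
   ((assocV X Y W ▷ Z) \oc assocV X (Y \ox W) Z)).
  rewrite -compA (comp_reassoc _ (esym (wr_comp _ _ _))) assocVK tensm_id.
  by rewrite comp1m assocVK.
have /= H := hexagon1 c X Y W; rewrite -!compA in H.
have /= P := pentagon X Y W Z; rewrite -!compA in P.
have /= P' := pentagon Y W X Z; rewrite -!compA in P'.
have /= P'' := pentagon Y X W Z; rewrite -!compA in P''.
rewrite /bz -!compA P (comp_reassoc _ (esym (assoc_lift2 _ _))) -!compA.
rewrite (comp_reassoc _ (esym P')) -!compA.
rewrite -[X in _ \oc (_ \oc (_ \oc X))]wr_comp -[X in _ \oc (_ \oc X)]wr_comp H !wr_comp.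
rewrite (comp_reassoc _ (wlr_assoc _ _ _)) -!compA.
rewrite (comp_reassoc _ (esym (wl_comp _ _ _))) assoc_lift2 wl_comp -!compA.
rewrite (comp_reassoc3 _ P'') -!compA wrA.
by rewrite (comp_reassoc _ (assoc_lift2 _ _)) -!compA.
Qed.

Lemma bz_tensl X Y W Z :
  (W ◁ assoc X Y Z) \oc bz (X \ox Y) W Z
  = bz X W (Y \ox Z) \oc ((X ◁ bz Y W Z) \oc assoc X Y (W \ox Z)).
Proof.
apply: (@split_epiP _ _ _ _ _ (assoc (X \ox Y) W Z) (assocV (X \ox Y) W Z)).
  by rewrite assocVK.
(* The second hexagon solved for the braiding of a product. *)
have H : brd c (X \ox Y) W = assoc W X Y \oc ((brd c X W ▷ Y)
    \oc (assocV X W Y \oc ((X ◁ brd c Y W) \oc assoc X Y W))).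
  apply: (split_monoP (assocVK W X Y)); rewrite [RHS]compA assocK comp1m.
  have := hexagon2 c X Y W; rewrite -!compA => H.
  apply: (split_epiP (assocK X Y W)).
  by rewrite -compA H -!compA assocVK compm1.
have /= P := pentagon X Y W Z; rewrite -!compA in P.
have /= P' := pentagon W X Y Z; rewrite -!compA in P'.
rewrite /bz -!compA -P -assoc_lift2 H !wr_comp (comp_reassoc3 _ P') -!compA.
rewrite (comp_reassoc _ (wrA _ _ _)) -!compA (comp_reassoc _ (pentagonVV _ _ _ _)).
rewrite -!compA (comp_reassoc _ (wlr_assoc _ _ _)) -!compA.
rewrite [in RHS](comp_reassoc _ (esym (wl_comp _ _ _))) -assoc_lift2 wl_comp -!compA.
rewrite (comp_reassoc _ (assoc_lift2 _ _)) -!compA.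
by rewrite (comp_reassoc _ (assocVK _ _ _)) comp1m.
Qed.

(** The hexagon at [X], 1, 1 and naturality of the braiding along [lunit] make both sides agree
    after composition with the invertible [brd c X unit_ob]. *)
Lemma brd_unit X : lunit X \oc brd c X unit_ob = runit X.
Proof.
apply: wr_unit_inj; rewrite wr_comp.
have [b /= [bK _]] := brd_iso c X unit_ob.
apply: (split_monoP bK).
have H := hexagon1 c X unit_ob unit_ob; rewrite -!compA in H.
rewrite -[in RHS]triangle compA [in RHS]compA (brd_nat c (idm X) (lunit _)).
by rewrite -!lunit_tens -!compA H [in RHS](comp_reassoc _ (lunit_nat _)) -!compA.
Qed.

Lemma bz_unit X Z : lunit (X \ox Z) \oc bz X unit_ob Z = X ◁ lunit Z.
Proof.
rewrite /bz lift2.unlock 2!compA lunit_tens -wr_comp brd_unit -triangle -compA.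
by rewrite assocVK compm1.
Qed.

(** A strand [Y] passes over a cap: the braiding is natural along [p], and braiding with the target
    of [p], the unit, is trivial. *)
Lemma cap_slide A B (p : mor (A \ox B) unit_ob) Y Z :
  cap p (Y \ox Z) \oc ((A ◁ bz Y B Z) \oc bz Y A (B \ox Z)) = Y ◁ cap p Z.
Proof.
apply: (@split_epiP _ _ _ _ _ (Y ◁ assoc A B Z) (Y ◁ assocV A B Z)).
  by rewrite -wl_comp assocVK tensm_id.
rewrite -!compA -bz_tensr compA cap_assoc -wl_comp cap_assoc wl_comp -bz_unit.
by rewrite -!compA bz_natr.
Qed.

(** Naturality of the braiding of [X] along [brd c Y W], with both sides expanded by the hexagon. *)
Lemma yang_baxter X Y W Z :
  (W ◁ bz X Y Z) \oc (bz X W (Y \ox Z) \oc (X ◁ bz Y W Z))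
  = bz Y W (X \ox Z) \oc ((Y ◁ bz X W Z) \oc bz X Y (W \ox Z)).
Proof.
apply: (@split_epiP _ _ _ _ _ (X ◁ assoc Y W Z) (X ◁ assocV Y W Z)).
  by rewrite -wl_comp assocVK tensm_id.
rewrite -!compA -bz_tensr -wl_comp -assoc_lift2 wl_comp.
rewrite (comp_reassoc3 _ (esym (bz_tensr _ _ _ _))) -!compA bz_natr.
by rewrite compA assoc_lift2 -compA.
Qed.

Definition monodromy X Y : mor (X \ox Y) (X \ox Y) := brd c Y X \oc brd c X Y.

Lemma assoc_monodromy X Y Z :
  assoc X Y Z \oc (monodromy X Y ▷ Z) = bz Y X Z \oc (bz X Y Z \oc assoc X Y Z).
Proof. by rewrite assoc_lift2 lift2_comp -compA. Qed.

End Braiding.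

(** * The Drinfeld morphism and the balancing identity *)

Section Drinfeld.
Variables (K : fieldType) (C : fusionCat K) (c : braiding C).
Implicit Types X Y Z W A B : C.

Local Notation evz X := (cap (ev (dualP X))).
Local Notation b := (bz c).

Lemma cap_tens A B (p : mor (A \ox B) unit_ob) Y Z :
  cap p Y ▷ Z = cap p (Y \ox Z) \oc ((A ◁ assoc B Y Z) \oc assoc A (B \ox Y) Z).
Proof.
apply: (@split_epiP _ _ _ _ _ (assoc A B Y ▷ Z) (assocV A B Y ▷ Z)).
  by rewrite -wr_comp assocVK tensm_id.
rewrite -wr_comp cap_assoc wr_comp -lunit_tens -compA wrA.
have /= := pentagon A B Y Z; rewrite -!compA => ->.
by rewrite [RHS]compA cap_assoc -compA.
Qed.

Lemma lift2_assoc A B Y Z :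
  (A ◁ assoc B Y Z) \oc lift2 (assoc A B Y) Z = assoc A B (Y \ox Z).
Proof.
apply: (split_epiP (assocVK (A \ox B) Y Z)).
by rewrite -compA -assoc_lift2 compA pentagon.
Qed.

Lemma cap_dualm X Y (f : mor X Y) Z :
  evz X Z \oc (dualm f ▷ (X \ox Z)) = evz Y Z \oc (dual_ob Y ◁ (f ▷ Z)).
Proof. by rewrite [dualm f]/(transp _ _) cap_transp cap_wl. Qed.

Lemma cap_drinfeld X Z :
  evz (dual_ob X) Z \oc (drinfeld c X ▷ (dual_ob X \ox Z))
  = evz X Z \oc b X (dual_ob X) Z.
Proof.
by rewrite [drinfeld c X]/(transp _ _) cap_transp cap_comp.
Qed.

Lemma drinfeld_nat X Y (f : mor X Y) :
  drinfeld c Y \oc f = dualm (dualm f) \oc drinfeld c X.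
Proof.
apply: (@pairing_inj _ _ _ _ (dualP (dual_ob Y))) => Z.
rewrite (wr_comp _ (drinfeld c Y)) (wr_comp _ (dualm _)) !compA.
rewrite cap_drinfeld cap_dualm -!compA -exchange.
by rewrite [in RHS]compA cap_drinfeld bz_natl [in LHS]compA -cap_dualm -!compA bz_natr.
Qed.

(** The pairing of [Y* (x) X*] with [X (x) Y] by nested evaluations, which [dual_tens X Y]
    represents. *)
Definition nested X Y Z :=
  evz Y Z \oc ((dual_ob Y ◁ evz X (Y \ox Z))
    \oc assoc (dual_ob Y) (dual_ob X) (X \ox (Y \ox Z))).

Lemma cap_dual_tens X Y Z :
  evz (X \ox Y) Z \oc (dual_tens X Y ▷ ((X \ox Y) \ox Z))
  = nested X Y Z \oc ((dual_ob Y \ox dual_ob X) ◁ assoc X Y Z).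
Proof.
rewrite [dual_tens X Y]/(transp _ _) cap_transp cap_comp.
rewrite (_ : _ \oc _ \oc _ = cap (ev (dualP X)) Y); last by rewrite cap.unlock.
rewrite cap_wl cap_tens !wl_comp /nested -!compA wlA.
by rewrite -[in RHS]lift2_assoc.
Qed.

(** Two zigzags, one for each factor, recover a morphism from its nested pairing. *)
Lemma nested_inj X Y A (f g : mor A (dual_ob Y \ox dual_ob X)) :
  (forall Z, nested X Y Z \oc (f ▷ (X \ox (Y \ox Z)))
             = nested X Y Z \oc (g ▷ (X \ox (Y \ox Z)))) ->
  f = g.
Proof.
move=> fg; apply: wr_unit_inj.
apply: (split_monoP (assocK _ _ _)).
set W := dual_ob Y \ox (dual_ob X \ox unit_ob).
have E h : assoc (dual_ob Y) (dual_ob X) unit_ob \oc (h ▷ unit_ob)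
    = nested X Y W \oc (h ▷ (X \ox (Y \ox W)))
      \oc (A ◁ (X ◁ cup (coev (dualP Y)) (dual_ob X \ox unit_ob)))
      \oc (A ◁ cup (coev (dualP X)) unit_ob).
  rewrite -!compA -!wl_comp exchange /nested !wl_comp -!compA.
  rewrite (comp_reassoc _ (wlA _ _ _)) -!compA (comp_reassoc _ (esym (wl_comp _ _ _))).
  rewrite (comp_reassoc _ (wlA _ _ _)) -!compA (comp_reassoc _ (esym (wl_comp _ _ _))).
  by rewrite -cap_nat -compA zigzag2Z compm1 [RHS]compA zigzag2Z comp1m.
by rewrite E fg -E.
Qed.

(** Pairing with [Y* (x) X*] leaves an identity of braids closed by two caps. The hexagons split the
    crossings of the products, the Yang-Baxter equation reorders them, and [cap_slide] removes one
    group of crossings at each cap. *)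
Lemma drinfeld_tens X Y :
  dualm (dual_tens X Y) \oc (drinfeld c (X \ox Y) \oc monodromy c X Y)
  = dual_tens (dual_ob Y) (dual_ob X) \oc (drinfeld c X \om drinfeld c Y).
Proof.
apply: (@pairing_inj _ _ _ _ (dualP (dual_ob Y \ox (dual_ob X)))) => Z.
rewrite (wr_comp _ (dualm _)) (wr_comp _ (drinfeld _ _)) (wr_comp _ (dual_tens _ _)).
rewrite compA cap_dualm -compA (comp_reassoc _ (esym (exchange _ _))).
rewrite -compA [LHS]compA cap_drinfeld -compA (comp_reassoc _ (bz_natr _ _ _ _)).
rewrite -compA [LHS]compA cap_dual_tens [RHS]compA cap_dual_tens.
(* On the right-hand side each Drinfeld factor, once paired, becomes a braided evaluation. *)
have E1 : nested (dual_ob Y) (dual_ob X) Z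
      \oc ((drinfeld c X \om drinfeld c Y) ▷ (dual_ob Y \ox (dual_ob X \ox Z)))
    = cap (ev (dualP X) \oc brd c X (dual_ob X)) Z
      \oc ((X ◁ cap (ev (dualP Y) \oc brd c Y (dual_ob Y)) (dual_ob X \ox Z))
           \oc assoc X Y (dual_ob Y \ox (dual_ob X \ox Z))).
  rewrite /nested -!compA assoc_nat -(wl_wr (drinfeld c X)) -compA.
  rewrite (comp_reassoc _ (esym (wl_comp _ _ _))).
  rewrite (comp_reassoc _ (esym (exchange _ _))) !cap_comp cap_drinfeld.
  by rewrite -compA compA cap_drinfeld -compA.
rewrite -[RHS]compA -(exchange (drinfeld c X \om drinfeld c Y)) [RHS]compA E1 -!compA.
rewrite (comp_reassoc _ (wlA _ _ _)) -!compA.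
rewrite (comp_reassoc _ (bz_tensr _ _ _ _ _)) -!compA.
rewrite -(exchange (monodromy c X Y)) !compA; congr (_ \oc _); rewrite -!compA.
rewrite 2!(comp_reassoc _ (esym (wl_comp _ _ _))) -!compA bz_tensl !wl_comp -!compA.
rewrite (comp_reassoc _ (bz_tensl _ _ _ _ _)) -!compA assoc_monodromy.
rewrite !compA; congr (_ \oc _); rewrite -!compA.
rewrite (comp_reassoc _ (esym (wl_comp _ _ _))) -[in LHS]cap_comp.
rewrite (comp_reassoc3 _ (esym (yang_baxter c Y X _ _))) -!compA.
rewrite 2!(comp_reassoc _ (esym (wl_comp _ _ _))) -!compA cap_slide.
rewrite (comp_reassoc _ (bz_nat _ _ _ _)) -!compA [LHS]compA -[in LHS]cap_comp.
by rewrite [LHS]compA -cap_nat -compA cap_slide.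
Qed.

Section Balance.
Variable psi : spherical_structure C.

(** The nested pairing factors through [dual_tens] and separates morphisms, so [dual_tens] can be
    cancelled without an explicit inverse. *)
Lemma dual_tens_mono X Y A (f g : mor A (dual_ob Y \ox dual_ob X)) :
  dual_tens X Y \oc f = dual_tens X Y \oc g -> f = g.
Proof.
move=> fg; apply: (@nested_inj X Y) => Z.
have E h : nested X Y Z \oc (h ▷ (X \ox (Y \ox Z)))
    = evz (X \ox Y) Z \oc ((dual_tens X Y \oc h) ▷ ((X \ox Y) \ox Z))
      \oc (A ◁ assocV X Y Z).
  rewrite (wr_comp _ (dual_tens X Y)) compA cap_dual_tens -!compA (exchange h).
  by rewrite (comp_reassoc _ (esym (wl_comp _ _ _))) assocVK tensm_id comp1m.
by rewrite E fg -E.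
Qed.

Lemma inv_twist_ex X : exists w : mor X X, sph psi X \oc w = drinfeld c X.
Proof.
have [g [_ gK]] := sph_iso psi X.
by exists (g \oc drinfeld c X); rewrite compA gK comp1m.
Qed.

Definition inv_twist X : mor X X := projT1 (cid (inv_twist_ex X)).

Lemma inv_twistP X : sph psi X \oc inv_twist X = drinfeld c X.
Proof. exact: projT2 (cid (inv_twist_ex X)). Qed.

Lemma sph_mono X Y (f g : mor X Y) : sph psi Y \oc f = sph psi Y \oc g -> f = g.
Proof. by have [h [hK _]] := sph_iso psi Y; apply: split_monoP hK. Qed.

Lemma inv_twist_nat X Y (f : mor X Y) : inv_twist Y \oc f = f \oc inv_twist X.
Proof.
apply: sph_mono; rewrite !compA inv_twistP drinfeld_nat sph_nat -compA.
by rewrite inv_twistP.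
Qed.

(** The quotient of [drinfeld_tens] by the monoidality of [psi]. *)
Lemma balancing X Y :
  inv_twist (X \ox Y) \oc monodromy c X Y = inv_twist X \om inv_twist Y.
Proof.
have [gX [gXK _]] := sph_iso psi X; have [gY [gYK _]] := sph_iso psi Y.
apply: (@split_monoP _ _ _ _ _ (sph psi X \om sph psi Y) (gX \om gY)).
  by rewrite -tensm_comp gXK gYK tensm_id.
apply: dual_tens_mono; rewrite -[in RHS]tensm_comp !inv_twistP -drinfeld_tens.
by rewrite compA -sph_tens -[LHS]compA -inv_twistP -(compA (sph psi _)).
Qed.

End Balance.

End Drinfeld.

(** Lets [linfun (compm f)] supply the matrix whose eigenvalues are used in [simple_end_scalar]. *)
HB.instance Definition _ (K : fieldType) (C : linCat K) (X Y Z : C) (g : mor Y Z) :=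
  GRing.isLinear.Build K (mor X Y) (mor X Z) _ (@compm K C X Y Z g) (comp_linr g).

(** * Schur's lemma, splittings and faithful tensoring *)

Section Semisimple.
Variables (K : fieldType) (C : fusionCat K).
Implicit Types X Y Z W A B S T : C.

Lemma kernel_mono X Y Z (f : mor X Y) (k : mor Z X) : kernel_of f k -> mono_mor k.
Proof.
move=> [fk0 kP] W g h kgh.
have [|u [_ uP]] := kP W (k \oc g); first by rewrite compA fk0 comp0m.
by rewrite -(uP g) // -(uP h).
Qed.

(** Schur's lemma: a kernel inclusion that is invertible would force [f = 0], so the kernel is zero
    and [f] is a monomorphism into a simple object. *)
Lemma simple_mor_iso S T (f : mor S T) :
  simple_ob S -> simple_ob T -> f != 0 -> iso_mor f.
Proof.
move=> [nzS sS] [nzT sT] nzf.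
have [_ kerC _ _ _] := fus_abelian C.
have [Z [k kP]] := kerC _ _ f; have [fk0 fkP] := kP.
case: (sS _ k (kernel_mono kP)) => [Z0|[g [_ kg]]]; last first.
  by case/eqP: nzf; rewrite -[f]compm1 -kg compA fk0 comp0m.
have fmono : mono_mor f.
  move=> W g h fgh; apply/subr0_eq.
  have [|u [<- _]] := fkP W (g - h); first by rewrite compmB fgh subrr.
  by rewrite -[u]comp1m Z0 comp0m compm0.
by case: (sT _ f fmono).
Qed.

(** Some entry of [f] between simple summands is nonzero, hence invertible; [g] is its inverse,
    extended by zero. *)
Lemma nonzero_split A B (f : mor A B) :
  f != 0 -> exists g : mor B A, g \oc f != 0 /\ f \oc g != 0.
Proof.
move=> nzf.
have [m [Y [sY [iY [pY [piY _ sumY]]]]]] := fus_semisimple A.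
have [n [Z [sZ [iZ [pZ [piZ _ sumZ]]]]]] := fus_semisimple B.
have [[i [j nz]]|all0] := pselect (exists i j, pZ j \oc f \oc iY i != 0).
  have [h [hf fh]] := simple_mor_iso (sY i) (sZ j) nz.
  exists (iY i \oc (h \oc pZ j)); split; apply/eqP => E0.
    have iE : iY i = (iY i \oc (h \oc pZ j) \oc f) \oc iY i.
      by rewrite -[LHS]compm1 -hf -!compA.
    by case: (sY i) => + _; apply; rewrite /zero_ob -piY iE E0 comp0m compm0.
  have pE : pZ j = pZ j \oc (f \oc (iY i \oc (h \oc pZ j))).
    by rewrite -[LHS]comp1m -fh -!compA.
  by case: (sZ j) => + _; apply; rewrite /zero_ob -piZ pE E0 compm0 comp0m.
case/eqP: nzf; rewrite -[f]comp1m -[_ \oc f]compm1 -sumY -sumZ.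
rewrite comp_sumr big1 // => i _; rewrite comp_suml comp_suml big1 // => j _.
rewrite -!compA; rewrite (compA f) (compA (pZ j)).
have -> : pZ j \oc (f \oc iY i) = 0.
  by apply/eqP/negPn/negP => nz; apply: all0; exists i, j; rewrite -compA.
by rewrite comp0m compm0.
Qed.

Lemma unit_id_neq0 : idm (unit_ob : C) != 0.
Proof.
apply/eqP => id0; have := fus_unit C.
suff -> : {: mor (unit_ob : C) unit_ob}%VS = 0%VS by rewrite dimv0.
apply/eqP; rewrite -subv0; apply/subvP => g _.
by rewrite -[g]comp1m id0 comp0m mem0v.
Qed.

Lemma unit_end_scalar (f : mor (unit_ob : C) unit_ob) : exists a, f = a *: idm _.
Proof.
have/vlineP[a ->] : f \in <[idm (unit_ob : C)]>%VS; last by exists a.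
suff -> : <[idm (unit_ob : C)]>%VS = {: mor (unit_ob : C) unit_ob}%VS by rewrite memvf.
by apply/eqP; rewrite eqEdim subvf dim_vline unit_id_neq0 fus_unit.
Qed.

Lemma unit_retraction B (f : mor unit_ob B) :
  f != 0 -> exists r : mor B unit_ob, r \oc f = idm unit_ob.
Proof.
move=> /nonzero_split[g [nzgf _]]; have [a ga] := unit_end_scalar (g \oc f).
exists (a^-1 *: g); rewrite compZm ga scalerA mulVf ?scale1r //.
by apply: contra_neq nzgf => a0; rewrite ga a0 scale0r.
Qed.

Definition faithful W := forall X Y (f g : mor X Y), f ▷ W = g ▷ W -> f = g.

Lemma faithful_unit : faithful unit_ob.
Proof. exact: wr_unit_inj. Qed.

Lemma faithful_tens W W' : faithful W -> faithful W' -> faithful (W \ox W').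
Proof.
move=> fW fW' X Y f g fg; apply/fW/fW'; apply: (split_monoP (assocK _ _ _)).
by rewrite !wrA fg.
Qed.

(** The coevaluation is nonzero by the zigzag, hence splits the unit off [W (x) W*]; so
    [f ▷ unit_ob] can be read off from [f ▷ W]. *)
Lemma faithful_nonzero W : ~ zero_ob W -> faithful W.
Proof.
move=> nzW X Y f g fg; have d := dualP W.
have nzc : coev d != 0.
  apply/eqP => c0; apply: nzW; rewrite /zero_ob -(zigzag1 d) c0 tens0m.
  by rewrite compm0 comp0m.
have [r rK] := unit_retraction nzc.
apply: wr_unit_inj.
have E h : h ▷ unit_ob = (Y ◁ r) \oc ((h ▷ (W \ox dual_ob W)) \oc (X ◁ coev d)).
  by rewrite exchange compA -wl_comp rK tensm_id comp1m.
rewrite E [in RHS]E; congr (_ \oc (_ \oc _)).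
apply: (split_epiP (assocVK X W (dual_ob W))).
by rewrite -!wrA fg.
Qed.

End Semisimple.

(* [e1 e2] has order dividing 2 up to the scalar [s ^- 8], and it is conjugate
   to its inverse. *)
Lemma involution_braid_scalar (K : fieldType) (C : linCat K) (A : C)
    (e1 e2 t : mor A A) (s : K) :
  idm A != 0 -> e1 \oc e1 = idm A -> e2 \oc e2 = idm A ->
  t \oc t = s ^+ 2 *: e2 -> e1 = s ^+ 2 *: (t \oc (e1 \oc t)) -> s ^+ 16 = 1.
Proof.
move=> nz e11 e22 tt e1E.
have r1 k : e1 \oc (e1 \oc k) = k by rewrite compA e11 comp1m.
have r2 k : e2 \oc (e2 \oc k) = k by rewrite compA e22 comp1m.
have rt k : t \oc (t \oc k) = s ^+ 2 *: (e2 \oc k) by rewrite compA tt compZm.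
have nzs : s != 0.
  by apply: contra_neq nz => s0; rewrite -e11 e1E s0 expr0n scale0r comp0m.
(* The product of two copies of [s^2 t e1 t] contains [t t = s^2 e2] in the middle, whence the
   exponent 6. *)
have sq : e1 \oc e1 = s ^+ 6 *: (t \oc (e1 \oc (e2 \oc (e1 \oc t)))).
  rewrite {1 2}e1E compZm compmZ -!compA rt !(compZm, compmZ) !scalerA.
  by rewrite -!exprD.
have P : idm A = s ^+ 8 *: (e1 \oc (e2 \oc (e1 \oc e2))).
  have E : s ^+ 2 *: e2 = s ^+ 10 *: (e2 \oc (e1 \oc (e2 \oc (e1 \oc e2)))).
    rewrite -{1}tt -{1}[t]compm1 -e11 sq compmZ compZm -!compA rt tt.
    by rewrite !compmZ !scalerA -!exprD.
  apply: (@scalerI _ _ (s ^+ 2)); first by rewrite expf_neq0.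
  by rewrite -e22 -compmZ E compmZ r2 scalerA -exprD.
have Q : idm A = s ^+ 8 *: (e2 \oc (e1 \oc (e2 \oc e1))).
  by rewrite -{1}e22 -{2}[e2]comp1m P compZm compmZ -!compA e22 compm1.
(* The words in [P] and [Q] are inverse to each other, so their product leaves only the scalar. *)
have : (s ^+ 8 *: (e1 \oc (e2 \oc (e1 \oc e2)))) \oc
    (s ^+ 8 *: (e2 \oc (e1 \oc (e2 \oc e1)))) = s ^+ 16 *: idm A.
  by rewrite compZm compmZ -!compA r2 r1 r2 e11 scalerA -exprD.
by rewrite -P -Q comp1m -{1}[idm A]scale1r => /(scalar_inj nz) <-.
Qed.

(** Left composition with [f] on [End X] has an eigenvalue [a]. Then [f - a] annihilates a nonzero
    endomorphism, so it is not invertible and vanishes by Schur's lemma. *)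
Lemma simple_end_scalar (K : closedFieldType) (C : fusionCat K) (X : C) (f : mor X X) :
  simple_ob X -> exists a, f = a *: idm X.
Proof.
move=> sX; have [nzX _] := sX.
pose L := linfun (compm f : mor X X -> mor X X).
pose M := f2mx L.
have dim_gt0 : (0 < dim (mor X X))%N.
  rewrite lt0n -dimvf dimv_eq0; apply: contra_notN nzX => /eqP V0.
  by apply/eqP; rewrite -memv0 -V0 memvf.
have [a] : exists a, root (char_poly M) a.
  by apply/closed_rootP; rewrite size_char_poly eqSS -lt0n.
rewrite -eigenvalue_root_char => /eigenvalueP[v vM nzv].
exists a; apply/subr0_eq/eqP/negPn/negP => nz.
have [g [gK _]] := simple_mor_iso sX sX nz.
have fv : f \oc r2v v = a *: r2v v.
  rewrite -[LHS](lfunE (compm f : mor X X -> mor X X)) unlock /= r2vK.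
  by rewrite -[f2mx _]/M vM linearZ.
case/eqP: nzv; apply: (can_inj (@r2vK _ (mor X X))).
rewrite linear0 -[LHS]comp1m -gK -compA compBm compZm comp1m fv subrr.
by rewrite compm0.
Qed.

(** * Double braidings and twist in a near-integral category *)

Section NearIntegral.
Variables (K : closedFieldType) (C : fusionCat K) (D : C -> Prop) (rho : C).
Hypotheses (D_near_integral : near_integral D).
Hypotheses (rho_simple : simple_ob rho) (rho_notin_D : ~ D rho).
Implicit Types X Y Z W A B : C.

Let D_sub : fusion_subcat D := D_near_integral.1.

(** The rank equation leaves at most one index outside [D], and the index of [rho] is such an
    index. *)
Lemma simple_dichotomy Y : simple_ob Y -> D Y \/ isomorphic rho Y.
Proof.
move=> sY; have [i [f [f' [ff' f'f]]]] := irr_full sY.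
have [k [g [g' [gg' g'g]]]] := irr_full rho_simple.
have [Di|nDi] := pselect (D (irr C i)).
  by left; apply: (fsub_retract D_sub Di); exists f, f'.
have nDk : ~ D (irr C k).
  by move=> Dk; apply: rho_notin_D; apply: (fsub_retract D_sub Dk); exists g, g'.
have : (#|[predC [pred i | `[< D (irr C i) >]]]| <= 1)%N.
  rewrite -(leq_add2l (subrank D)) cardC card_ord.
  by rewrite D_near_integral.2.
move/card_le1_eqP => le1; have ik : i = k.
  by apply: le1; rewrite !inE; apply/asboolPn.
right; rewrite ik in f f' ff' f'f.
exists (f' \oc g), (g' \oc f); split.
  by rewrite -compA (compA f) f'f comp1m.
by rewrite -compA (compA g) g'g comp1m.
Qed.

Lemma D_to_rho A (f : mor A rho) : D A -> f = 0.
Proof.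
move=> DA; apply/eqP/negPn/negP => /nonzero_split[g [_ nz]].
have [h [_ fgh]] := simple_mor_iso rho_simple rho_simple nz.
apply: rho_notin_D; apply: (fsub_retract D_sub DA).
by exists (g \oc h), f; rewrite compA.
Qed.

(** A factorisation of the identity through copies of [rho]: natural endomorphisms of [A] are then
    determined by their value on [rho]. *)
Definition rho_multiple A :=
  exists n (a : 'I_n -> mor rho A) (b : 'I_n -> mor A rho),
    \sum_i (a i \oc b i) = idm A.

Lemma rho_multipleP A :
  (forall Y (f : mor Y A), D Y -> f = 0) -> rho_multiple A.
Proof.
move=> noD; have [n [Y [sY [iY [pY [piY _ sumY]]]]]] := fus_semisimple A.
have iso i : exists uv : mor rho (Y i) * mor (Y i) rho, uv.1 \oc uv.2 = idm (Y i).
  have [DY|[u [v [_ vu]]]] := simple_dichotomy (sY i); last by exists (u, v).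
  by case: (sY i) => + _; case; rewrite /zero_ob -piY (noD _ (iY i) DY) compm0.
pose uv i := projT1 (cid (iso i)); have uvP i := projT2 (cid (iso i)).
exists n, (fun i => iY i \oc (uv i).1), (fun i => (uv i).2 \oc pY i).
rewrite -sumY; apply: eq_bigr => i _.
by rewrite -compA (compA (uv i).1) (uvP i) comp1m.
Qed.

(** Duality turns a morphism [Y -> X (x) rho] with [Y] in [D] into a morphism [X* (x) Y -> rho] out
    of an object of [D], which is zero. *)
Lemma tens_rho_multiple X : D X -> rho_multiple (X \ox rho).
Proof.
move=> DX; apply: rho_multipleP => Y f DY; have d := dualP X.
have f'0 : cap (ev (dualP X)) rho \oc (dual_ob X ◁ f) = 0.
  by apply: D_to_rho; apply: (fsub_tens D_sub) => //; apply: (fsub_dual D_sub).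
rewrite -[f]comp1m -(zigzag1Z (dualP X)) -compA cup_nat compA -wl_comp f'0.
by rewrite tensm0 comp0m.
Qed.

Lemma rho_faithful : faithful rho.
Proof. by apply: faithful_nonzero; case: rho_simple. Qed.

Section Braided.
Variables (c : braiding C) (psi : spherical_structure C).

Local Notation w := (inv_twist c psi).
Local Notation M := (monodromy c).

Lemma inv_twist_multiple A s :
  w rho = s *: idm rho -> rho_multiple A -> w A = s *: idm A.
Proof.
move=> ws [n [a [b abA]]]; rewrite -[w A]compm1 -abA comp_sumr scaler_sumr.
apply: eq_bigr => i _.
by rewrite compA inv_twist_nat ws compmZ compm1 compZm.
Qed.

Lemma monodromy_nat X X' Y Y' (f : mor X X') (g : mor Y Y') :
  M X' Y' \oc (f \om g) = (f \om g) \oc M X Y.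
Proof. by rewrite /monodromy -compA brd_nat compA brd_nat -compA. Qed.

Lemma monodromy_multiple X A (g : mor X X) :
  M X rho = g ▷ rho -> rho_multiple A -> M X A = g ▷ A.
Proof.
move=> Mg [n [a [b abA]]].
have E (h : mor (X \ox A) (X \ox A)) : h = \sum_i (h \oc (X ◁ (a i \oc b i))).
  by rewrite -comp_sumr -tensm_sum abA tensm_id compm1.
rewrite [LHS]E [RHS]E; apply: eq_bigr => i _.
by rewrite wl_comp compA monodromy_nat Mg -exchange -compA.
Qed.

Lemma monodromy_split_epi X Y : exists N, M X Y \oc N = idm _.
Proof.
have [f [_ fK]] := brd_iso c X Y; have [g [_ gK]] := brd_iso c Y X.
by exists (f \oc g); rewrite /monodromy -compA (compA (brd c X Y)) fK comp1m.
Qed.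

(** If it vanished, so would the evaluation, because the braiding is invertible; the zigzag would
    then kill the identity. This makes the scalar of [w] on [rho] nonzero. *)
Lemma drinfeld_neq0 X : ~ zero_ob X -> drinfeld c X <> 0.
Proof.
move=> nzX u0; apply: nzX.
have p0 : ev (dualP X) \oc brd c X (dual_ob X) = 0.
  rewrite -[LHS](ev_transp (dualP (dual_ob X))).
  by rewrite [transp _ _]u0 tens0m compm0.
have [b [_ bK]] := brd_iso c X (dual_ob X).
rewrite /zero_ob -(zigzag1 (dualP X)).
by rewrite -[ev _]compm1 -bK compA p0 comp0m tensm0 !(comp0m, compm0).
Qed.

Lemma rho_scalar : exists2 s, s != 0 & w rho = s *: idm rho.
Proof.
have [s ws] := simple_end_scalar (w rho) rho_simple; exists s => //.
apply: contra_notN (drinfeld_neq0 rho_simple.1) => /eqP s0.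
by rewrite -(inv_twistP c psi) ws s0 scale0r compm0.
Qed.

(* The twist is the same scalar on [rho] and on [X (x) rho]. *)
Lemma monodromy_rho X : D X -> M X rho = w X ▷ rho.
Proof.
move=> DX; have [s nzs ws] := rho_scalar.
have := balancing c psi X rho.
rewrite ws (inv_twist_multiple ws (tens_rho_multiple DX)) compZm comp1m tensmZ.
exact: scalerI.
Qed.

(** By the hexagons, the loop of [X] around [W] sits between the two crossings of [X] with [Y]. It
    equals [g] by hypothesis, and naturality moves [g] out past the first crossing. *)
Lemma monodromy_tensr X Y W (g : mor X X) Z :
  M X W = g ▷ W ->
  (X ◁ assoc Y W Z) \oc lift2 (M X (Y \ox W)) Z
  = lift2 (M X Y \oc (g ▷ Y)) (W \ox Z) \oc (X ◁ assoc Y W Z).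
Proof.
move=> Mg; rewrite lift2_comp lift2_wr lift2_comp -!/(bz _ _ _ _) compA bz_tensl.
rewrite -!compA bz_tensr (comp_reassoc _ (esym (wl_comp _ _ _))).
have -> : bz c W X Z \oc bz c X W Z = g ▷ (W \ox Z).
  by rewrite -lift2_comp -/(M X W) Mg lift2_wr.
by rewrite (comp_reassoc _ (esym (bz_natl _ _ _ _))) [in RHS]lift2_comp -!compA.
Qed.

(** Here the double braiding of [X] and [W] appears between the two crossings of [Y] with [W]. *)
Lemma monodromy_tensl X Y W Z :
  assoc X Y (W \ox Z) \oc lift2 (M (X \ox Y) W) Z
  = (X ◁ bz c W Y Z) \oc (bz c W X (Y \ox Z) \oc (bz c X W (Y \ox Z)
    \oc ((X ◁ bz c Y W Z) \oc assoc X Y (W \ox Z)))).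
Proof.
rewrite lift2_comp (comp_reassoc _ (bz_tensr c W X Y Z)) -!compA.
by rewrite -[lift2 _ Z]/(bz c (X \ox Y) W Z) bz_tensl.
Qed.

Lemma lift2_faithful X Y X' Y' W (f g : mor (X \ox Y) (X' \ox Y')) :
  faithful W -> lift2 f W = lift2 g W -> f = g.
Proof.
move=> fW fg; apply: fW; apply: (split_monoP (assocK _ _ _)).
by rewrite !assoc_lift2 fg.
Qed.

Lemma faithful_rho1 : faithful (rho \ox unit_ob).
Proof. by apply: faithful_tens; [apply: rho_faithful | apply: faithful_unit]. Qed.

(* Both sides of [M X (Y (x) rho) = w X (x) (Y (x) rho)] contain the invertible
   factor [w X], whence [M X Y] is trivial. *)
Lemma monodromy_D X Y : D X -> D Y -> M X Y = idm _.
Proof.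
move=> DX DY; apply: (lift2_faithful faithful_rho1); rewrite lift2_id.
have MX := monodromy_rho DX.
have MYr : M X (Y \ox rho) = w X ▷ (Y \ox rho).
  exact: monodromy_multiple MX (tens_rho_multiple DY).
apply: (@split_epiP _ _ _ _ _ (X ◁ assoc Y rho unit_ob) (X ◁ assocV Y rho unit_ob)).
  by rewrite -wl_comp assocVK tensm_id.
have [N NK] := monodromy_split_epi X (Y \ox rho).
apply: (@split_epiP _ _ _ _ _ (lift2 (M X (Y \ox rho)) unit_ob) (lift2 N unit_ob)).
  by rewrite -lift2_comp NK lift2_id.
rewrite comp1m [RHS](monodromy_tensr _ _ MX) lift2_comp lift2_wr MYr lift2_wr.
by rewrite -!compA exchange.
Qed.

Lemma monodromy_rho_rho X : D X -> M X (rho \ox rho) = (w X \oc w X) ▷ (rho \ox rho).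
Proof.
move=> DX; have MX := monodromy_rho DX; apply: lift2_inj.
apply: (@split_monoP _ _ _ _ _ (X ◁ assoc rho rho unit_ob) (X ◁ assocV rho rho unit_ob)).
  by rewrite -wl_comp assocK tensm_id.
by rewrite (monodromy_tensr _ _ MX) MX -wr_comp !lift2_wr exchange.
Qed.

Lemma inv_twist_D_of_hom (j : mor rho (rho \ox rho)) X : j != 0 -> D X -> w X = idm X.
Proof.
move=> /nonzero_split[g [nz _]] DX.
have [h [hK _]] := simple_mor_iso rho_simple rho_simple nz.
have MX := monodromy_rho DX; have [N NK] := monodromy_split_epi X rho.
have ww : (w X \oc w X) ▷ rho = w X ▷ rho.
  (* [h \oc g] is a left inverse of [j]; naturality of the double braiding along [j] relates its
     values at [rho] and at [rho (x) rho]. *)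
  apply: (@split_monoP _ _ _ _ _ (X ◁ j) (X ◁ (h \oc g))).
    by rewrite -wl_comp -compA hK tensm_id.
  by rewrite -exchange -monodromy_rho_rho // monodromy_nat MX.
apply: rho_faithful; rewrite tensm_id; apply: (split_epiP NK).
by rewrite MX comp1m -wr_comp.
Qed.

Lemma rho_rho_D : (forall j : mor rho (rho \ox rho), j = 0) -> D (rho \ox rho).
Proof.
move=> no; have [n [Y [sY dY]]] := fus_semisimple (rho \ox rho).
apply: (fsub_sum D_sub _ dY) => i; have [//|[u [v [vu uv]]]] := simple_dichotomy (sY i).
have [iY [pY [piY _ _]]] := dY; case: (sY i) => + _; case; rewrite /zero_ob.
by rewrite -piY -[iY i]compm1 -uv (compA (iY i)) (no (iY i \oc u)) comp0m compm0.
Qed.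

Lemma faithful_rho_rho : faithful (rho \ox rho).
Proof. by apply: faithful_tens; apply: rho_faithful. Qed.

Lemma inv_twist_sq X : D (rho \ox rho) -> D X -> w X \oc w X = idm X.
Proof.
move=> Drr DX; apply: faithful_rho_rho.
by rewrite tensm_id -monodromy_rho_rho // monodromy_D.
Qed.

Lemma inv_twist_rho_16 s : D (rho \ox rho) -> w rho = s *: idm rho -> s ^+ 16 = 1.
Proof.
move=> Drr ws; set e := w (rho \ox rho).
have ee : e \oc e = idm _ := inv_twist_sq Drr Drr.
have Me : M rho rho = s ^+ 2 *: e.
  have := balancing c psi rho rho; rewrite -/e ws tensZm tensmZ tensm_id scalerA.
  by move=> /(congr1 (compm e)); rewrite compA ee comp1m compmZ compm1.
(* The trailing unit closes the families, so [A] stands for the threefold tensor power of [rho]. *)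
pose W := rho \ox unit_ob; pose A := rho \ox (rho \ox W).
pose e1 : mor A A := lift2 e W; pose e2 : mor A A := rho ◁ lift2 e unit_ob.
pose c2 : mor A A := rho ◁ bz c rho rho unit_ob.
have nzA : idm A != 0.
  apply/eqP => A0; case: rho_simple => + _; apply.
  apply: (faithful_tens rho_faithful faithful_rho1).
  by rewrite tensm_id tens0m.
apply: (involution_braid_scalar nzA (e1 := e1) (e2 := e2) (t := c2)).
- by rewrite -lift2_comp ee lift2_id.
- by rewrite -wl_comp -lift2_comp ee lift2_id tensm_id.
- by rewrite -wl_comp -lift2_comp [_ \oc _]Me lift2Z tensmZ.
(* As [rho (x) rho] lies in [D], [e1] is its double braiding with [rho]. Its expansion by
   [monodromy_tensl] is the double braiding of the first two factors, [s^2 e1], between two copies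
   of [c2]. *)
apply: (split_epiP (assocVK rho rho W)).
rewrite -assoc_lift2 -lift2_wr -monodromy_rho // monodromy_tensl compZm -!compA.
rewrite [X in _ \oc X](comp_reassoc _ (_ : _ = s ^+ 2 *: e1)); last first.
  by rewrite -lift2_comp [_ \oc _]Me lift2Z.
by rewrite compZm compmZ.
Qed.

End Braided.

End NearIntegral.

(** * Loops of duals and their transport along braided functors *)

Section HalfDual.
Variables (K : fieldType) (C : monCat K).
Implicit Types X Y Z : C.

(** The comparison map [phi : Xd -> X'] turns [p'] into [p] and [q] into [q'], and passes through
    the braiding by naturality. *)
Lemma half_dual_loop (c : braiding C) X Xd X'
    (p : mor (Xd \ox X) unit_ob) (q : mor unit_ob (X \ox Xd))
    (p' : mor (X' \ox X) unit_ob) (q' : mor unit_ob (X \ox X')) :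
  half_dual p q -> half_dual p' q' ->
  p \oc (brd c X Xd \oc q) = p' \oc (brd c X X' \oc q').
Proof.
move=> pq pq'; apply: wr_unit_inj.
suff E : cap p unit_ob \oc (bz c X Xd unit_ob \oc cup q unit_ob)
    = cap p' unit_ob \oc (bz c X X' unit_ob \oc cup q' unit_ob).
  move: E; rewrite 2!compA -!cap_comp !cap_cup -!compA => E.
  apply: (split_monoP (lunitK _)); apply: (split_epiP (lunitK _)).
  by rewrite -!compA.
set Z := unit_ob; pose phi := transp p q'.
have -> : cap p Z = cap p' Z \oc (phi ▷ (X \ox Z)).
  rewrite transp_wr compA (cap_nat p) -compA -wl_comp half_dual_cap_cup //.
  by rewrite tensm_id compm1.
have <- : (X ◁ (phi ▷ Z)) \oc cup q Z = cup q' Z.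
  rewrite transp_wr wl_comp -compA -cup_nat compA half_dual_cap_cup //.
  by rewrite comp1m.
by rewrite -compA (comp_reassoc _ (esym (bz_natr _ _ _ _))) -!compA.
Qed.

End HalfDual.

Section BraidedFunctor.
Variables (K : fieldType) (M N : monCat K) (c : braiding M) (d : braiding N).
Variables (F : braidedFunctor c d).
Implicit Types X Y : M.

(** The images of [p] and [q] are corrected by the unit and tensor constraints of [F]; linearity
    preserves the scalar of the loop. *)
Lemma half_dual_functor X Xd (p : mor (Xd \ox X) unit_ob) (q : mor unit_ob (X \ox Xd)) a :
  half_dual p q -> p \oc (brd c X Xd \oc q) = a *: idm unit_ob ->
  exists (p' : mor (F Xd \ox F X) unit_ob) (q' : mor unit_ob (F X \ox F Xd)),
    half_dual p' q' /\ p' \oc (brd d (F X) (F Xd) \oc q') = a *: idm unit_ob.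
Proof.
move=> pq ploop.
have [u [uK Ku]] := funit_iso F; have [t [tK Kt]] := ftens_iso F X Xd.
exists (u \oc (fmor F p \oc ftens F Xd X)), (t \oc (fmor F q \oc funit F)); split.
  rewrite /half_dual.
  apply: (split_epiP (lunitVK (F X))); rewrite -compA lunitK compm1 comp1m.
  rewrite -(ftens_runit F X) -(ftens_lunit F X).
  rewrite !wl_comp !wr_comp -!compA.
  rewrite (comp_reassoc _ (esym (wl_comp _ _ _))) Ku tensm_id comp1m.
  have tl f : ftens F X unit_ob \oc (F X ◁ fmor F f) = fmor F (X ◁ f) \oc ftens F X _.
    by move=> *; rewrite -ftens_nat fmor_id.
  have tr f : ftens F _ X \oc (fmor F f ▷ F X) = fmor F (f ▷ X) \oc ftens F _ X.
    by rewrite -ftens_nat fmor_id.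
  have fA := esym (ftens_assoc F X Xd X); rewrite -!compA in fA.
  rewrite (comp_reassoc _ (tl _ _)) -!compA (comp_reassoc3 _ fA) -!compA.
  rewrite (comp_reassoc _ (esym (wr_comp _ _ _))) Kt tensm_id comp1m.
  rewrite (comp_reassoc _ (tr _ _ _)) !compA -!fmor_comp; congr (fmor F _ \oc _ \oc _).
  by apply: (split_epiP (lunitK X)); rewrite pq lunitVK.
have fB := esym (ftens_brd F X Xd).
rewrite -!compA (comp_reassoc _ fB) -!compA (comp_reassoc _ Kt) comp1m.
rewrite 2!(comp_reassoc _ (esym (fmor_comp F _ _))) -compA.
have -> : fmor F (p \oc (brd c X Xd \oc q)) = a *: idm _.
  have fZ (f : mor (unit_ob : M) unit_ob) : fmor F (a *: f) = a *: fmor F f.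
    have f0 : fmor F (0 : mor (unit_ob : M) unit_ob) = 0.
      have := fmor_lin F 1 (0 : mor (unit_ob : M) unit_ob) 0.
      rewrite !scale1r addr0 => /(congr1 (fun x => x - fmor F 0)).
      by rewrite addrK subrr => <-.
    by have := fmor_lin F a f 0; rewrite f0 !addr0.
  by rewrite ploop fZ fmor_id.
by rewrite compZm comp1m compmZ uK.
Qed.

End BraidedFunctor.

(** * Odd representations and their negative loop *)

Lemma sum_mxtens (V : nmodType) m n (E : 'I_(m * n) -> V) :
  \sum_k E k = \sum_i \sum_j E (mxtens_index (i, j)).
Proof.
rewrite pair_bigA (reindex (@mxtens_index m n)) /=; last first.
  by exists (@mxtens_unindex m n) => k _; rewrite (mxtens_indexK, mxtens_unindexK).
by apply: eq_bigr => -[].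
Qed.

Section DualRepresentation.
Variables (K : numFieldType) (gT : finGroupType) (G : {group gT}).
Variable V : rep_ob K G.
Let n := rdim V.

Fact dual_rep_subproof : mx_repr G (fun x => (V x^-1%g)^T).
Proof.
split; first by rewrite invg1 repr_mx1 trmx1.
by move=> x y Gx Gy; rewrite invMg repr_mxM ?groupV // trmx_mul.
Qed.

Definition dual_rep : rep_ob K G := RepOb (MxRepresentation dual_rep_subproof).

Definition rep_ev_mx : 'M[K]_(1, n * n) :=
  \row_k ((mxtens_unindex k).1 == (mxtens_unindex k).2)%:R.
Definition rep_coev_mx : 'M[K]_(n * n, 1) := rep_ev_mx^T.

Lemma rep_ev_mxE i j k : rep_ev_mx i (mxtens_index (j, k)) = (j == k)%:R.
Proof. by rewrite mxE mxtens_indexK. Qed.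

Lemma rep_coev_mxE i j k : rep_coev_mx (mxtens_index (j, k)) i = (j == k)%:R.
Proof. by rewrite mxE rep_ev_mxE. Qed.

Lemma sum_delta (E : 'I_n -> K) i : \sum_j (j == i)%:R * E j = E i.
Proof.
rewrite (bigD1 i) //= eqxx mul1r big1 ?addr0 // => j /negPf ->.
by rewrite mul0r.
Qed.

Fact rep_ev_subproof x : x \in G ->
  rep_ev_mx *m rep_tens dual_rep V x = rep_unit K G x *m rep_ev_mx.
Proof.
move=> Gx; rewrite /= mul1mx; apply/matrixP => i k; case: (mxtens_indexP k) => {}k l.
rewrite rep_ev_mxE mxE sum_mxtens.
under eq_bigr => a _.
  under eq_bigr => b _ do rewrite rep_ev_mxE tensmxE eq_sym.
  rewrite sum_delta. over.
have VV : V x^-1%g *m V x = 1%:M by rewrite -repr_mxM ?groupV // mulVg repr_mx1.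
have /esym := congr1 (fun A : 'M_n => A k l) VV; rewrite !mxE => ->.
by apply: eq_bigr => a _; rewrite !mxE.
Qed.

Fact rep_coev_subproof x : x \in G ->
  rep_coev_mx *m rep_unit K G x = rep_tens V dual_rep x *m rep_coev_mx.
Proof.
move=> Gx; rewrite /= mulmx1; apply/matrixP => k i; case: (mxtens_indexP k) => {}k l.
rewrite rep_coev_mxE mxE sum_mxtens.
under eq_bigr => a _.
  under eq_bigr => b _ do rewrite rep_coev_mxE tensmxE mulrC eq_sym.
  rewrite sum_delta. over.
have VV : V x *m V x^-1%g = 1%:M by rewrite -repr_mxM ?groupV // mulgV repr_mx1.
have /esym := congr1 (fun A : 'M_n => A k l) VV; rewrite !mxE => ->.
by apply: eq_bigr => a _; rewrite !mxE.
Qed.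

Definition rep_ev : rep_hom (rep_tens dual_rep V) (rep_unit K G) :=
  @rep_mor _ _ _ (rep_tens dual_rep V) (rep_unit K G) _ rep_ev_subproof.
Definition rep_coev : rep_hom (rep_unit K G) (rep_tens V dual_rep) :=
  @rep_mor _ _ _ (rep_unit K G) (rep_tens V dual_rep) _ rep_coev_subproof.

Lemma rep_half_dual : @half_dual K (rep_mon K G) V dual_rep rep_ev rep_coev.
Proof.
apply: rep_hom_eq => /=; apply/matrixP => i j.
rewrite mul_mx_pmx mxE sum_mxtens sum_mxtens.
transitivity (\sum_a (a == i)%:R
    * \sum_b (b == a)%:R * \sum_k (k == j)%:R * (b == k)%:R : K).
  apply: eq_bigr => a _; rewrite mulr_sumr; apply: eq_bigr => b _; rewrite !mulr_sumr.
  apply: eq_bigr => k _; rewrite mul_mx_pmx (mul_pmx_mx _ _ _ (@runitfK _) (@runitVfK _)).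
  rewrite /assocf /runitVf /lunitVf !mxtens_indexK /= !tensmxE.
  rewrite rep_ev_mxE rep_coev_mxE !mxE.
  by rewrite (eq_sym i) (eq_sym a b); ring.
by rewrite !sum_delta mxE.
Qed.

Variables (nu : gT) (nuZ : nu \in 'Z(G)%g) (nu2 : (nu * nu = 1)%g).

(** Both [V] and its dual are purely odd, so the Koszul sign is -1 and the loop is minus the trace
    of the identity. *)
Lemma rep_loop_odd : V nu = - 1%:M ->
  (rep_ev : @mor K (rep_mon K G) _ _)
    \oc (brd (rep_braiding K nuZ nu2) V dual_rep \oc rep_coev)
  = - n%:R *: idm (unit_ob : rep_mon K G).
Proof.
move=> Vnu.
have oddV : odd_part nu V = 1%:M.
  rewrite /odd_part Vnu opprK -mulr2n -scaler_nat scalerA mulVf ?scale1r //.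
  by rewrite pnatr_eq0.
have nuV : nu^-1%g = nu by apply/eqP; rewrite eq_invg_mul nu2.
have oddV' : odd_part nu dual_rep = 1%:M.
  rewrite /odd_part /= nuV Vnu linearN /= trmx1 opprK -mulr2n -scaler_nat scalerA.
  by rewrite mulVf ?scale1r // pnatr_eq0.
apply: rep_hom_eq => /=; rewrite /koszul_sign oddV oddV' tens1mx1.
rewrite mulr2n opprD addrA subrr sub0r.
rewrite mulmxN mulNmx mulmx1 mulmxN scaleNr; congr (- _).
apply/matrixP => i j; rewrite mulmxA mxE sum_mxtens.
transitivity (\sum_(k < n) (1 : K)).
  apply: eq_bigr => a _; rewrite -[RHS](sum_delta (fun=> 1) a); apply: eq_bigr => b _.
  rewrite mul_mx_pmx /swapf mxtens_indexK rep_ev_mxE rep_coev_mxE (eq_sym a).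
  by case: eqP; rewrite ?mul0r.
by rewrite sumr_const card_ord (ord1 i) (ord1 j) !mxE eqxx mulr1.
Qed.

End DualRepresentation.

(** The image of [1 - nu] in the regular representation: a submodule as [nu] is central, nonzero by
    faithfulness, and odd since [(1 - nu) nu = -(1 - nu)]. *)
Lemma odd_rep_exists (K : numFieldType) (gT : finGroupType) (G : {group gT})
    (nu : gT) (nuZ : nu \in 'Z(G)%g) (nu2 : (nu * nu = 1)%g) :
  nu <> 1%g -> exists V : rep_ob K G, (0 < rdim V)%N /\ V nu = - 1%:M.
Proof.
move=> nu1; have [Gnu cnu] : nu \in G /\ centralises nu G by apply/centerP.
pose rG := regular_repr K G; pose U := 1%:M - rG nu.
have Umod : mxmodule rG U.
  apply/mxmoduleP => x Gx; rewrite mulmxBl mul1mx -repr_mxM //.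
  by rewrite cnu // repr_mxM // -{1}[rG x]mulmx1 -mulmxBr submxMl.
exists (RepOb (submod_repr Umod)); split => /=.
  rewrite lt0n mxrank_eq0 subr_eq0; apply/eqP => rnu.
  apply: nu1; apply/set1gP; apply: (subsetP (regular_mx_faithful K G)).
  by rewrite inE Gnu mul1mx -rnu /=.
apply/row_matrixP => i; rewrite !rowE; apply: val_submod_inj.
rewrite -[LHS]/(val_submod (delta_mx 0 i *m submod_repr Umod nu)) val_submodJ //.
rewrite mulmxN mulmx1 linearN /=.
have /submxP[D ->] := val_submodP (delta_mx 0 i : 'rV_(\rank U)).
rewrite -mulmxN -mulmxA mulmxBl mul1mx -repr_mxM // nu2 repr_mx1.
by rewrite opprB.
Qed.

(** * Comparison of traces and conclusion *)

Lemma trace_drinfeld (K : fieldType) (C : fusionCat K) (c : braiding C) (X : C) :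
  trace_mor (drinfeld c X)
  = ev (dualP X) \oc (brd c X (dual_ob X) \oc coev (dualP X)).
Proof. by rewrite /trace_mor [drinfeld c X]/(transp _ _) ev_transp compA. Qed.

Lemma super_tannakian_negative_trace (K : numFieldType) (C : fusionCat K)
    (c : braiding C) (P : C -> Prop) : super_tannakian c P ->
  exists X n, [/\ P X, (0 < n)%N & trace_mor (drinfeld c X) = - n%:R *: idm unit_ob].
Proof.
move=> [gT [G [nu [nuZ [nu2 [nu1 [F [_ FP]]]]]]]].
have [V [V_gt0 Vnu]] := odd_rep_exists K nuZ nu2 nu1.
have [p [q [pq loop]]] :=
  half_dual_functor F (@rep_half_dual _ _ _ V) (rep_loop_odd nuZ nu2 Vnu).
exists (F (V : rep_mon K G)), (rdim V); split=> //.
  apply/FP; exists V; exists (idm _); exists (idm _); by rewrite /inverse_mors !comp1m.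
(* The transported dual may differ from the chosen [dual_ob], but the loop is the same. *)
by rewrite trace_drinfeld -loop; apply: half_dual_loop => //; apply: zigzag1.
Qed.

Lemma FPdim_ob_ge0 (R : realType) (K : fieldType) (C : fusionCat K) (X : C) :
  0 <= FPdim_ob R X.
Proof.
rewrite /FPdim_ob; set E := (E in sup E).
(* For a set without a supremum, [sup] has the default value 0. *)
have [[[x Ex] Eb]|nE] := pselect (classical_sets.has_sup E); last by rewrite sup_out.
by apply: le_trans Ex.1 _; apply: ub_le_sup.
Qed.

Theorem proposition4p12 (R : realType) (C : fusionCat R[i]) (c : braiding C)
    (psi : spherical_structure C) (D : C -> Prop) (rho : C)
    (psi_canonical : canonical_spherical psi)
    (D_near_integral : near_integral D)
    (rho_simple : simple_ob rho) (rho_notin_D : ~ D rho)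
    (FPdim_int : FPdim R C \is a Num.int)
    (D_super : super_tannakian c (symmetric_center c D)) :
  [/\ forall X : C, D X <-> symmetric_center c D X,
      \dim {: mor rho (rho \ox rho)} = 0%N
    & twist c psi rho ^+ 16 = 1].
Proof.
(* Otherwise [w X = 1], so [psi] and the Drinfeld morphism agree on an [X] of negative trace, which
   gives [FPdim X = -n < 0]. *)
have no_hom (j : mor rho (rho \ox rho)) : j = 0.
  apply/eqP/negPn/negP => nz.
  have [X [n [[DX _] n_gt0 tr]]] := super_tannakian_negative_trace D_super.
  have w1 := inv_twist_D_of_hom D_near_integral rho_simple rho_notin_D c psi nz DX.
  have := psi_canonical X.
  rewrite -[sph psi X]compm1 -w1 inv_twistP tr => /(scalar_inj (unit_id_neq0 C)) E.
  have := FPdim_ob_ge0 R X; rewrite -ler0c -E oppr_ge0 lern0 => /eqP n0.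
  by rewrite n0 in n_gt0.
have Drr := rho_rho_D D_near_integral rho_simple rho_notin_D no_hom.
have [s nzs ws] := rho_scalar rho_simple c psi.
have s16 := inv_twist_rho_16 D_near_integral rho_simple rho_notin_D Drr ws.
split.
- move=> X; split=> [DX|[]//]; split=> // Y DY.
  exact: (monodromy_D D_near_integral rho_simple rho_notin_D c psi DX DY).
- apply/eqP; rewrite dimv_eq0 -subv0; apply/subvP => j _.
  by rewrite (no_hom j) mem0v.
have uE : drinfeld c rho = s *: sph psi rho.
  by rewrite -(inv_twistP c psi) ws compmZ compm1.
have nz_psi : sph psi rho != 0.
  apply: contra_notN rho_simple.1 => /eqP psi0.
  by have [g [gK _]] := sph_iso psi rho; rewrite /zero_ob -gK psi0 compm0.
(* Since [sph psi rho] is nonzero, any scalar chosen by [xget] is [s^-1]; the same scalar excludes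
   the default branch. *)
rewrite /twist; case: classical_sets.xgetP => [t _ /= tP|no_t].
  suff -> : t = s^-1 by rewrite exprVn s16 invr1.
  apply: (mulfI nzs); rewrite divff //; apply: (scalar_inj nz_psi).
  by rewrite scale1r [RHS]tP uE compmZ compm1 scalerA mulrC.
case: (no_t s^-1) => /=.
by rewrite uE compmZ compm1 scalerA mulVf // scale1r.
Qed.
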